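(* Let $X=(X_t)_{t\in[0,1]}$ be a real-valued stochastic process whose increments have finite second moments, and suppose there are constants $C_0>0$ and $\iota\ge0$ such that for all $p\ge 1$ and all $s,t\in[0,1]$ $$\mathbb{E}|X_t-X_s|^p\le C_0^p\,p^{p\iota}\left[\mathbb{E}|X_t-X_s|^2\right]^{p/2}.$$ Let $\alpha>0$. Then $X$ (up to modification) is H\''older continuous of any order $\gamma<\alpha$, i.e. for any $\epsilon>0$ there is an almost surely finite random variable $C_\epsilon(\omega)$ such that almost surely, for all $s\neq t$ in $[0,1]$, $$|X_t-X_s|\le C_\epsilon(\omega)|t-s|^{\alpha-\epsilon},$$ if and only if for any $\epsilon>0$ there is a constant $C_\epsilon>0$ such that for all $s\neq t$ in $[0,1]$ $$\mathbb{E}(X_t-X_s)^2\le C_\epsilon|t-s|^{2\alpha-\epsilon}.$$ Moreover, in this case (if $\iota>0$) for every $\epsilon>0$ the H\''older constant $C_\epsilon(\omega)=\sup_{s\ne t}\frac{|X_t-X_s|}{|t-s|^{\alpha-\epsilon}}$ of $X$ satisfies $$\mathbb{E}\exp\left(\beta\,C_\epsilon(\omega)^{1/\iota}\right)<\infty$$ for small enough $\beta>0$ which depends only on $C_0$, $\alpha$, $\iota$, and $\epsilon$.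
   Context: A modification of $X$ is a process $\tilde X$ on the same probability space with $P(\tilde X_t=X_t)=1$ for every $t$. ''Up to modification'' means that $X$ has a modification, still denoted $X$, with the stated sample path property.
   Formalization: The threshold for β is allowed to depend also on the constant C_ε in E(X_t−X_s)² ≤ C_ε|t−s|^{2α−ε} for the same ε, besides C_0, α, ι, ε; without it the claim fails under scaling, e.g. X_t = λtN with N standard Gaussian. *)

(* Defs.v *)
From HB Require Import structures.
From mathcomp Require Import all_boot all_order all_algebra.
From mathcomp Require Import all_classical all_reals all_analysis.
From mathcomp Require Import measurable_realfun.

Set Implicit Arguments.
Unset Strict Implicit.
Unset Printing Implicit Defensive.

Import Order.TTheory GRing.Theory Num.Theory.
Import numFieldNormedType.Exports.

Local Open Scope classical_set_scope.
Local Open Scope ring_scope.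

(* A process indexed by [0, 1] is a family X : R -> {RV P >-> R}; all the
   definitions below only look at X t for t in [0, 1], so the values of X
   outside [0, 1] are irrelevant. *)

Definition increments_L2 d (T : measurableType d) (R : realType)
    (P : probability T R) (X : R -> {RV P >-> R}) : Prop :=
  forall s t : R, s \in `[0, 1] -> t \in `[0, 1] ->
    ('E_P[fun w => ((X t w - X s w) ^+ 2)%R] < +oo)%E.

(* Both sides are extended reals: in particular the p-th moments of the
   increments are finite as soon as the second moments are. *)
Definition moments_growth d (T : measurableType d) (R : realType)
    (P : probability T R) (C0 iota : R) (X : R -> {RV P >-> R}) : Prop :=
  forall p s t : R, 1 <= p -> s \in `[0, 1] -> t \in `[0, 1] ->
    ('E_P[fun w => (`|X t w - X s w| `^ p)%R]
       <= (C0 `^ p * p `^ (p * iota))%R%:E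
          * 'E_P[fun w => (`|X t w - X s w| ^+ 2)%R] `^ (p / 2))%E.

Definition modification d (T : measurableType d) (R : realType)
    (P : probability T R) (X Y : R -> {RV P >-> R}) : Prop :=
  forall t : R, t \in `[0, 1] -> P [set w | Y t w = X t w] = 1%E.

(* The order alpha - eps may be negative. *)
Definition holder_paths d (T : measurableType d) (R : realType)
    (P : probability T R) (alpha : R) (X : R -> {RV P >-> R}) : Prop :=
  forall eps : R, 0 < eps ->
    exists C : {RV P >-> \bar R},
      {ae P, forall w, (C w < +oo)%E} /\
      {ae P, forall w, forall s t : R,
         s \in `[0, 1] -> t \in `[0, 1] -> s != t ->
         (`|X t w - X s w|%R%:E <= C w * (`|t - s| `^ (alpha - eps))%R%:E)%E}.

Definition second_moment_le d (T : measurableType d) (R : realType)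
    (P : probability T R) (K r : R) (X : R -> {RV P >-> R}) : Prop :=
  forall s t : R, s \in `[0, 1] -> t \in `[0, 1] -> s != t ->
    ('E_P[fun w => ((X t w - X s w) ^+ 2)%R] <= (K * `|t - s| `^ r)%R%:E)%E.

Definition holder_const d (T : measurableType d) (R : realType)
    (P : probability T R) (g : R) (X : R -> {RV P >-> R}) (w : T) : \bar R :=
  ereal_sup [set z | exists s t : R,
    [/\ s \in `[0, 1], t \in `[0, 1], s != t
      & z = (`|X t w - X s w| / `|t - s| `^ g)%R%:E]].

(* Main.v *)
(* For the direct implication, bound the second moment of an increment D on the
   event where the Hölder constant is large by Young's inequality and the
   hypercontractive bound E D^4 <= B (E D^2)^2; if that event has small
   probability, this part is absorbed in E D^2.
   For the converse, the moment growth gives E |X_t - X_s|^p <=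
   (A p^iota |t - s|^r)^p for every r < alpha, so summing over neighbouring
   dyadic points the supremum M of 2^(n g) |X_((i+1)/2^n) - X_(i/2^n)| has
   E M^p <= 2 (A p^iota)^p for large p, whenever g < r. Chaining shows that M
   controls the g-Hölder constant of the limit along dyadic points, which is a
   modification by Fatou's lemma.
   The growth of the moments of M gives exponential moments of M^(1/iota), but
   with a rate depending on the constant L for the exponent r. To get a rate
   depending on K only, compare the (alpha - eps)-quotients with those of a
   fine enough dyadic grid: the error is a small multiple of M, and the finitely
   many grid quotients have p-th moments at most (C0 sqrt(K) p^iota)^p. *)
Require Import Defs.
From HB Require Import structures.
From mathcomp Require Import all_boot all_order all_algebra.
From mathcomp Require Import all_classical all_reals all_analysis.
From mathcomp Require Import measurable_realfun.
From mathcomp Require Import ring lra zify.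

Set Implicit Arguments.
Unset Strict Implicit.
Unset Printing Implicit Defensive.

Import Order.TTheory GRing.Theory Num.Theory.
Import numFieldNormedType.Exports.

Local Open Scope classical_set_scope.
Local Open Scope ring_scope.

(** * Chaining along dyadic points *)

Lemma dist01_le1 (R : realDomainType) (s t : R) :
  s \in `[0, 1] -> t \in `[0, 1] -> `|t - s| <= 1.
Proof. by rewrite !in_itv /= => /andP[? ?] /andP[? ?]; rewrite ler_norml; lra. Qed.

Lemma dyadic_itv (R : realType) n i :
  (i <= 2 ^ n)%N -> (i%:R / 2 ^+ n : R) \in `[0, 1].
Proof.
move=> i2; rewrite in_itv /= divr_ge0 ?exprn_ge0//= ler_pdivrMr ?exprn_gt0//.
by rewrite mul1r -natrX ler_nat.
Qed.

(** Rounding down maps [[0, 1]] to itself, and roundings at consecutive levels agree or are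
    neighbours on the finer grid. *)
Definition dyadic_point (R : realType) (n : nat) (t : R) : R :=
  (Num.truncn (2 ^+ n * t))%:R / 2 ^+ n.

(** For [q = 2 ^ (- g)] this bounds the [g]-Hölder quotients of neighbouring dyadic points by [M]; a
    general [q] reduces chaining to geometric sums. *)
Definition dyadic_increments_le (R : realType) (f : R -> R) (M q : R) :=
  forall n i : nat, (i < 2 ^ n)%N ->
    `|f (i.+1%:R / 2 ^+ n) - f (i%:R / 2 ^+ n)| <= M * q ^+ n.

Lemma truncn_dyadic_le (R : realType) n (t : R) : t <= 1 ->
  (Num.truncn (2 ^+ n * t) <= 2 ^ n)%N.
Proof.
move=> t1; rewrite truncn_le_nat -[(_ ^ _)%N.+1%:R]natr1 natrX.
have : 2 ^+ n * t <= 2 ^+ n by rewrite ler_piMr// exprn_ge0.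
by move=> /le_lt_trans; apply; rewrite ltrDl.
Qed.

Lemma dyadic_point_le (R : realType) n (t : R) : 0 <= t ->
  dyadic_point n t <= t < dyadic_point n t + (2 ^+ n)^-1.
Proof.
move=> t0; have e0 : 0 < (2 : R) ^+ n by rewrite exprn_gt0.
have /andP[] := truncn_itv (mulr_ge0 (ltW e0) t0).
rewrite /dyadic_point -[(Num.truncn _).+1%:R]natr1 => h1 h2.
rewrite ler_pdivrMr// [t * _]mulrC h1 /= -[X in _ < _ + X]mul1r -mulrDl ltr_pdivlMr//.
by rewrite mulrC.
Qed.

Lemma dyadic_point_itv (R : realType) n (t : R) : t \in `[0, 1] ->
  dyadic_point n t \in `[0, 1].
Proof.
rewrite !in_itv /= => /andP[t0 t1]; rewrite divr_ge0 ?exprn_ge0//=.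
by have /andP[+ _] := dyadic_point_le n t0; move/le_trans; exact.
Qed.

Lemma dyadic_point_dist (R : realType) n (t : R) : 0 <= t ->
  `|t - dyadic_point n t| <= (2 ^+ n)^-1.
Proof. by move=> /(dyadic_point_le n)/andP[h1 h2]; rewrite ger0_norm; lra. Qed.

Lemma truncn_dyadicS (R : realType) n (t : R) : 0 <= t ->
  let k := Num.truncn (2 ^+ n * t) in
  Num.truncn (2 ^+ n.+1 * t) = k.*2 \/ Num.truncn (2 ^+ n.+1 * t) = k.*2.+1.
Proof.
move=> t0 k; have e0 : 0 <= (2 : R) ^+ n * t by rewrite mulr_ge0// exprn_ge0.
have /andP[h1 h2] := truncn_itv e0; rewrite -/k -[k.+1%:R]natr1 in h1 h2.
rewrite exprS -mulrA; set x := 2 ^+ n * t in h1 h2 e0 *.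
have [hx|hx] := ltP (2 * x) (k.*2.+1)%:R.
  left; apply: truncn_def; rewrite hx andbT -mul2n natrM; lra.
right; apply: truncn_def; rewrite hx /= -[_.*2.+2%:R]natr1 -[_.*2.+1%:R]natr1 -mul2n natrM; lra.
Qed.

Section dyadic_chaining.
Variables (R : realType) (f : R -> R) (M q : R).
Hypotheses (M_ge0 : 0 <= M) (q_gt0 : 0 < q) (q_lt1 : q < 1).
Hypothesis f_le : dyadic_increments_le f M q.

Lemma dyadic_pointS_le n (t : R) : t \in `[0, 1] ->
  `|f (dyadic_point n.+1 t) - f (dyadic_point n t)| <= M * q ^+ n.+1.
Proof.
rewrite in_itv /= => /andP[t0 t1]; rewrite /dyadic_point.
set k := Num.truncn (2 ^+ n * t).
have E : (k%:R / 2 ^+ n : R) = k.*2%:R / 2 ^+ n.+1.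
  by rewrite -mul2n natrM exprS -mulf_div divff// mul1r.
have := truncn_dyadic_le n.+1 t1.
have [->|->] := truncn_dyadicS n t0; rewrite -/k => kn.
  by rewrite E subrr normr0 mulr_ge0// exprn_ge0// ltW.
by rewrite E; apply: f_le.
Qed.

Lemma dyadic_point_near n (s t : R) : s \in `[0, 1] -> t \in `[0, 1] -> s <= t ->
  t - s <= (2 ^+ n)^-1 ->
  `|f (dyadic_point n t) - f (dyadic_point n s)| <= M * q ^+ n.
Proof.
rewrite !in_itv /= => /andP[s0 s1] /andP[t0 t1] st d.
have e0 : 0 < (2 : R) ^+ n by rewrite exprn_gt0.
have := truncn_dyadic_le n t1; rewrite /dyadic_point.
have kl : (Num.truncn (2 ^+ n * s) <= Num.truncn (2 ^+ n * t))%N.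
  by rewrite le_truncn// ler_wpM2l// ltW.
have kl1 : (Num.truncn (2 ^+ n * t) <= (Num.truncn (2 ^+ n * s)).+1)%N.
  rewrite truncn_le_nat -[(Num.truncn (2 ^+ n * s)).+2%:R]natr1.
  have /andP[_ h] := truncn_itv (mulr_ge0 (ltW e0) s0).
  have : 2 ^+ n * (t - s) <= 1 by rewrite mulrC -ler_pdivlMr// mul1r.
  rewrite mulrBr -[(Num.truncn (2 ^+ n * s)).+1%:R]natr1 in h *.
  lra.
set k := Num.truncn (2 ^+ n * s) in kl kl1 *.
set l := Num.truncn (2 ^+ n * t) in kl kl1 *.
have [->|->] : l = k \/ l = k.+1 by lia.
  by rewrite subrr normr0 mulr_ge0// exprn_ge0// ltW.
exact: f_le.
Qed.

Lemma dyadic_point_tail n m (t : R) : t \in `[0, 1] ->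
  `|f (dyadic_point (n + m) t) - f (dyadic_point n t)|
    <= M * q ^+ n * (1 - q)^-1.
Proof.
move=> t01; have q1 : 0 < 1 - q by rewrite subr_gt0.
(* The induction keeps the partial geometric sum. A factor [q] of the exact sum is given away; the
   resulting slack [q ^+ m * (1 - q) ^+ 2] closes the inductive step. *)
suff : `|f (dyadic_point (n + m) t) - f (dyadic_point n t)|
    <= M * q ^+ n * ((1 - q ^+ m) / (1 - q)).
  move/le_trans; apply; rewrite ler_wpM2l//.
    by rewrite mulr_ge0// exprn_ge0// ltW.
  rewrite ler_pdivrMr// mulVf ?gt_eqF// lerBlDr lerDl exprn_ge0//; exact: ltW.
elim: m => [|m ih]; first by rewrite addn0 subrr normr0 expr0 subrr mul0r mulr0.
have h := dyadic_pointS_le (n + m) t01; rewrite addnS.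
rewrite (le_trans (ler_distD (f (dyadic_point (n + m) t)) _ _))//.
rewrite (le_trans (lerD h ih))//.
have -> : M * q ^+ (n + m).+1 + M * q ^+ n * ((1 - q ^+ m) / (1 - q)) =
    M * q ^+ n * ((1 - q ^+ m + (1 - q) * (q * q ^+ m)) / (1 - q)).
  rewrite exprS exprD; field; exact: lt0r_neq0.
rewrite ler_wpM2l//; first by rewrite mulr_ge0// exprn_ge0// ltW.
rewrite ler_wpM2r ?invr_ge0 ?(ltW q1)// exprS.
have qm : 0 <= q ^+ m by rewrite exprn_ge0// ltW.
have := mulr_ge0 qm (sqr_ge0 (1 - q)); nra.
Qed.

Lemma is_cvg_dyadic_point (t : R) : t \in `[0, 1] ->
  cvgn (fun n => f (dyadic_point n t)).
Proof.
move=> t01.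
have -> : (fun n => f (dyadic_point n t)) =
    (fun n => f (dyadic_point 0 t) + series
      (fun k => f (dyadic_point k.+1 t) - f (dyadic_point k t)) n).
  by apply/funext => n; rewrite /series /= telescope_sumr// addrC subrK.
apply: is_cvgD; first exact: is_cvg_cst.
apply: normed_cvg; apply: (@series_le_cvg _ _ (geometric (M * q) q)).
- by move=> n; rewrite normr_ge0.
- by move=> n; rewrite /= !mulr_ge0// ?exprn_ge0// ltW.
- by move=> n; rewrite /= -mulrA -exprS; exact: dyadic_pointS_le.
- by apply: is_cvg_geometric_series; rewrite gtr0_norm.
Qed.

Variable h : R -> R.
Hypothesis fh : forall t : R, t \in `[0, 1] ->
  (fun n => f (dyadic_point n t)) @ \oo --> h t.

(** Let the finer level tend to infinity in the tail bound. The limit [h] may differ from [f]: later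
    [f] is a path of the process and [h] one of its modification. *)
Lemma dyadic_point_lim n (t : R) : t \in `[0, 1] ->
  `|h t - f (dyadic_point n t)| <= M * q ^+ n * (1 - q)^-1.
Proof.
move=> t01.
have /cvg_norm hn : (fun m => f (dyadic_point (m + n) t)
    - f (dyadic_point n t)) @ \oo --> h t - f (dyadic_point n t).
  apply: cvgB; last exact: cvg_cst.
  by move: (fh t01); rewrite -(cvg_shiftn n).
rewrite -(cvg_lim _ hn)//; apply: limr_le; first exact: (cvgP _ hn).
by apply: nearW => m; rewrite addnC; exact: dyadic_point_tail.
Qed.

(** Going from [h t] to [h s] through the two roundings costs two tails and one grid step, hence
    [1 + 2 / (1 - q)]. *)
Lemma dyadic_lim_le n (s t : R) : s \in `[0, 1] -> t \in `[0, 1] -> s <= t ->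
  t - s <= (2 ^+ n)^-1 ->
  `|h t - h s| <= M * (1 + 2 * (1 - q)^-1) * q ^+ n.
Proof.
move=> s01 t01 st d.
have h1 := dyadic_point_near s01 t01 st d.
have h2 := dyadic_point_lim n t01.
have := dyadic_point_lim n s01; rewrite distrC => h3.
rewrite (le_trans (ler_distD (f (dyadic_point n t)) _ _))//.
rewrite (le_trans (lerD h2 (ler_distD (f (dyadic_point n s)) _ _)))//.
rewrite (le_trans (lerD (lexx _) (lerD h1 h3)))//.
by rewrite le_eqVlt; apply/orP; left; apply/eqP; ring.
Qed.

End dyadic_chaining.

(** * Hölder bounds from dyadic increments *)

Lemma dyadic_scale (R : realType) (x : R) : 0 < x <= 1 ->
  exists n, (2 ^+ n.+1)^-1 < x <= (2 ^+ n)^-1.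
Proof.
move=> /andP[x0 x1].
have ex : exists n, (2 ^+ n.+1)^-1 < x.
  exists (Num.truncn x^-1).
  have h : x^-1 < (2 : R) ^+ (Num.truncn x^-1).+1.
    rewrite (lt_le_trans (truncnS_gt _))// -natrX ler_nat ltnW//.
    exact: ltn_expl.
  by rewrite invf_plt// posrE// exprn_gt0.
have /andP[] : ((2 ^+ (ex_minn ex).+1)^-1 < x) && (x <= (2 ^+ (ex_minn ex))^-1).
  case: ex_minnP => -[|n] hn hmin.
    by rewrite hn expr0 invr1 x1.
  rewrite hn /=; case: leP => // hx.
  by have := hmin _ hx; rewrite ltnn.
by move=> h1 h2; exists (ex_minn ex); rewrite h1 h2.
Qed.

Lemma powR2N_lt1 (R : realType) (g : R) : 0 < g -> 2 `^ (- g) < 1 :> R.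
Proof.
move=> g0; have : 1 `^ g < 2 `^ g :> R by rewrite gt0_ltr_powR ?nnegrE// ltr1n.
by rewrite powR1 powRN invf_lt1 ?powR_gt0.
Qed.

Lemma powR2N_expr (R : realType) (g : R) n :
  (2 `^ (- g)) ^+ n = ((2 ^+ n)^-1) `^ g :> R.
Proof.
rewrite -powR_mulrn ?powR_ge0// -powRrM mulNr mulrC -mulNr powRrM.
by rewrite powRN powR_mulrn.
Qed.

(** At the level [n] with [2 ^ (- n - 1) < t - s <= 2 ^ (- n)], the factor [2 ^ (- n g)] is at most
    [2 ^ g (t - s) ^ g]. *)
Lemma dyadic_increments_holder (R : realType) (f h : R -> R) (M g : R) :
  0 <= M -> 0 < g -> dyadic_increments_le f M (2 `^ (- g)) ->
  (forall t : R, t \in `[0, 1] -> (fun n => f (dyadic_point n t)) @ \oo --> h t) ->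
  forall s t : R, s \in `[0, 1] -> t \in `[0, 1] ->
    `|h t - h s|
      <= 2 `^ g * (1 + 2 * (1 - 2 `^ (- g))^-1) * M * `|t - s| `^ g.
Proof.
move=> M0 g0 fM fh.
have q1 : 2 `^ (- g) < 1 :> R by exact: powR2N_lt1.
have q0 : 0 < 2 `^ (- g) :> R by rewrite powR_gt0.
have key (s t : R) : s \in `[0, 1] -> t \in `[0, 1] -> s <= t -> `|h t - h s|
    <= 2 `^ g * (1 + 2 * (1 - 2 `^ (- g))^-1) * M * `|t - s| `^ g.
  move=> s01 t01; rewrite le_eqVlt => /predU1P[->|st].
    by rewrite !subrr normr0 powR0 ?gt_eqF// mulr0.
  have [n /andP[n1 n2]] : exists n, (2 ^+ n.+1)^-1 < t - s <= (2 ^+ n)^-1.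
    apply: dyadic_scale; move: s01 t01; rewrite !in_itv /= => s01 t01.
    by apply/andP; split; lra.
  rewrite (le_trans (dyadic_lim_le M0 q0 q1 fM fh s01 t01 (ltW st) n2))//.
  rewrite gtr0_norm ?subr_gt0//.
  have -> : 2 `^ g * (1 + 2 * (1 - 2 `^ (- g))^-1) * M * (t - s) `^ g =
    M * (1 + 2 * (1 - 2 `^ (- g))^-1) * (2 `^ g * (t - s) `^ g) by ring.
  rewrite ler_wpM2l//.
    by rewrite mulr_ge0// addr_ge0// mulr_ge0// invr_ge0 subr_ge0 ltW.
  rewrite powR2N_expr -powRM//; last by rewrite subr_ge0 ltW.
  apply: ge0_ler_powR; rewrite ?nnegrE ?invr_ge0 ?exprn_ge0 ?(ltW g0)//.
    by rewrite mulr_ge0// subr_ge0 ltW.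
  by rewrite -ler_pdivrMl// -invfM -exprS ltW.
move=> s t s01 t01; have [st|/ltW ts] := leP s t; first exact: key.
by rewrite distrC (distrC t); exact: key.
Qed.

(** * Exponential moments from growth of power moments *)

Lemma nneseries_EFin (R : realType) (u : R ^nat) : cvgn (series u) ->
  (\sum_(0 <= k <oo) (u k)%:E)%E = (limn (series u))%:E.
Proof.
move=> cu; rewrite -EFin_lim//; apply: congr_lim; apply/funext => n /=.
by rewrite /series /= sumEFin.
Qed.

Lemma expR_nneseries (R : realType) (x : R) :
  (expR x)%:E = (\sum_(0 <= k <oo) (exp_coeff x k)%:E)%E.
Proof. by rewrite nneseries_EFin //; exact: is_cvg_series_exp_coeff. Qed.

Lemma geometric_nneseries (R : realType) (a q : R) : 0 <= q < 1 ->
  (\sum_(0 <= k <oo) (a * q ^+ k)%:E)%E = (a / (1 - q))%:E.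
Proof.
move=> /andP[q0 q1]; have nq : `|q| < 1 by rewrite ger0_norm.
rewrite (@nneseries_EFin _ (geometric a q)); last exact: is_cvg_geometric_series.
by congr (_%:E); apply: cvg_lim => //; exact: cvg_geometric_series.
Qed.

(** The left side is one term of the series of [exp k], whose terms are all nonnegative. *)
Lemma exprnn_fact_le (R : realType) (k : nat) :
  k%:R ^+ k / k`!%:R <= expR 1 ^+ k :> R.
Proof.
rewrite -expRM_natl mulr1 -lee_fin expR_nneseries.
apply: le_trans (nneseries_lim_ge k.+1 _); last first.
  by move=> n _ _; rewrite lee_fin exp_coeff_ge0.
rewrite big_nat_recr//= sumEFin -EFinD lee_fin ler_wpDl// sumr_ge0// => i _.
by rewrite exp_coeff_ge0.
Qed.

Lemma powR_le1D (R : realType) (x r s : R) : 0 <= x -> 0 <= r <= s ->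
  x `^ r <= 1 + x `^ s.
Proof.
move=> x0 /andP[r0 rs]; have [x1|x1] := leP x 1.
  rewrite (@le_trans _ _ 1)// ?lerDl ?powR_ge0//.
  rewrite -[leRHS](powRr0 x).
  have : x `^ r <= 1 `^ r by rewrite ge0_ler_powR ?nnegrE.
  by rewrite powR1 powRr0.
by rewrite (@le_trans _ _ (x `^ s)) ?lerDr// ler_powR// ltW.
Qed.

Section exponential_moment.
Context d (T : measurableType d) (R : realType) (P : probability T R).

(** The exponential series is integrated termwise. Its [k]-th term involves the moment of order
    [k / iota], whose factor [(k / iota) ^ k] is absorbed by [k!]; the smallness of [beta] makes the
    ratio one half. *)
Lemma exponential_moment_fin (Z : T -> R) (A B iota beta p0 : R) :
  measurable_fun setT Z -> (forall w, 0 <= Z w) ->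
  0 < iota -> 0 <= A -> 0 <= B -> 0 <= beta -> 0 <= p0 ->
  (forall p, p0 <= p ->
    (\int[P]_w (Z w `^ p)%:E <= (B * (A * p `^ iota) `^ p)%:E)%E) ->
  beta * (A `^ iota^-1 * iota^-1 * expR 1) <= 2^-1 ->
  (\int[P]_w (expR (beta * Z w `^ iota^-1))%:E < +oo)%E.
Proof.
move=> mZ Z0 iota0 A0 B0 b0 p00 hZ hb.
have mZp p : measurable_fun setT (fun w => (Z w `^ p)%:E).
  by apply/measurable_EFinP; exact: (measurableT_comp (measurable_powR p) mZ).
pose t k := (\int[P]_w (exp_coeff (beta * Z w `^ iota^-1) k)%:E)%E.
have tE k : t k = ((beta ^+ k / k`!%:R)%:E * \int[P]_w (Z w `^ (k%:R / iota))%:E)%E.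
  rewrite /t -ge0_integralZl//=; last 2 first.
  - by move=> w _; rewrite lee_fin powR_ge0.
  - by rewrite lee_fin divr_ge0// exprn_ge0.
  apply: eq_integral => w _; rewrite -EFinM; congr (_%:E).
  rewrite /exp_coeff /= exprMn mulrAC; congr (_ * _).
  by rewrite -powR_mulrn ?powR_ge0// -powRrM mulrC.
have t0 k : (0 <= t k)%E.
  apply: integral_ge0 => w _; rewrite lee_fin exp_coeff_ge0// mulr_ge0//.
  exact: powR_ge0.
(* The growth bound is available from [p0] on only, so a moment of lower order is compared with one
   of order at least [p0]. *)
have tfin k : (t k < +oo)%E.
  rewrite tE lte_mul_pinfty ?lee_fin ?divr_ge0 ?exprn_ge0//.
  pose p := Num.max p0 (k%:R / iota).
  have kp : 0 <= k%:R / iota <= p.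
    by rewrite divr_ge0 ?(ltW iota0)//= /p le_max lexx orbT.
  apply: (@le_lt_trans _ _ (\int[P]_w (1%:E + (Z w `^ p)%:E))%E).
    apply: ge0_le_integral => //.
    - by move=> w _; rewrite lee_fin powR_ge0.
    - by apply: emeasurable_funD => //; exact: mZp.
    - by move=> w _; rewrite -EFinD lee_fin powR_le1D.
  rewrite ge0_integralD//; last by move=> w _; rewrite lee_fin powR_ge0.
  rewrite integral_cst//= probability_setT mule1 lte_add_pinfty ?ltry//.
  by rewrite (le_lt_trans (hZ p _)) ?ltry// /p le_max lexx.
(* From [N] on the orders [k / iota] exceed [p0]; the finitely many earlier terms only have to be
   finite. *)
pose N := (Num.truncn (p0 * iota)).+1.
(* [k^k / k! <= e^k] turns the k-th term of the exponential series into
   [B (beta A^(1/iota) e / iota)^k]. *)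
have tN k : (N <= k)%N -> (t k <= (B * (2^-1) ^+ k)%:E)%E.
  move=> Nk; rewrite tE.
  have pk : p0 <= k%:R / iota.
    rewrite ler_pdivlMr// (le_trans (ltW (truncnS_gt _)))// ler_nat//.
  apply: (le_trans (lee_wpmul2l _ (hZ _ pk))).
    by rewrite lee_fin divr_ge0// exprn_ge0.
  rewrite -EFinM lee_fin mulrCA ler_wpM2l//.
  have -> : (A * (k%:R / iota) `^ iota) `^ (k%:R / iota) =
      (A `^ iota^-1) ^+ k * (k%:R / iota) ^+ k.
    rewrite powRM ?powR_ge0// -powRrM mulrCA divff ?gt_eqF// mulr1.
    rewrite powR_mulrn ?divr_ge0 ?(ltW iota0)//; congr (_ * _).
    by rewrite mulrC powRrM powR_mulrn ?powR_ge0.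
  have -> : beta ^+ k / k`!%:R * (A `^ iota^-1 ^+ k * (k%:R / iota) ^+ k) =
     (beta * (A `^ iota^-1 / iota)) ^+ k * (k%:R ^+ k / k`!%:R).
    by rewrite !exprMn; ring.
  have c0 : 0 <= beta * (A `^ iota^-1 / iota).
    by rewrite mulr_ge0// divr_ge0 ?powR_ge0 ?(ltW iota0).
  apply: (le_trans (ler_wpM2l _ (exprnn_fact_le R k))); first exact: exprn_ge0.
  rewrite -exprMn lerXn2r ?nnegrE ?invr_ge0 ?(mulr_ge0 c0) ?expR_ge0//.
  by rewrite -mulrA.
under eq_integral do rewrite expR_nneseries.
rewrite integral_nneseries//; last 2 first.
- move=> k; apply/measurable_EFinP; apply: measurable_funM => //=.
  apply: measurable_funX; apply: measurable_funM => //.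
  by apply/measurable_EFinP; exact: mZp.
- by move=> k w _; rewrite lee_fin exp_coeff_ge0// mulr_ge0 ?powR_ge0.
rewrite (nneseries_split 0%N N); last by move=> k _; exact: t0.
rewrite add0n lte_add_pinfty//.
  by apply: lte_sum_pinfty => k _; exact: tfin.
apply: (@le_lt_trans _ _ (\sum_(0 <= k <oo) (B * (2^-1) ^+ k)%:E)%E); last first.
  by rewrite geometric_nneseries ?ltry// invr_ge0 ler0n/= invf_lt1// ltr1n.
rewrite [leRHS](nneseries_split 0%N N); last first.
  by move=> k _; rewrite lee_fin mulr_ge0// exprn_ge0.
rewrite add0n -[leLHS]add0e leeD//.
  by apply: sume_ge0 => k _; rewrite lee_fin mulr_ge0// exprn_ge0.
rewrite -[leLHS](nneseries_addn N)// -[leRHS](nneseries_addn N); last first.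
  by move=> k; rewrite lee_fin mulr_ge0// exprn_ge0.
apply: lee_nneseries => [k _ _|k _]; first exact: t0.
by apply: tN; rewrite leq_addl.
Qed.

End exponential_moment.

(** * Increments and modifications *)

Section increments.
Context d (T : measurableType d) (R : realType) (P : probability T R).
Implicit Types X Y : R -> {RV P >-> R}.

Lemma measurable_increment X (s t : R) :
  measurable_fun setT (fun w => `|X t w - X s w|).
Proof.
by apply: measurableT_comp => //; apply: measurable_funB.
Qed.

Lemma measurable_increment_powR X (s t p : R) :
  measurable_fun setT (fun w => (`|X t w - X s w| `^ p)%:E).
Proof.
apply/measurable_EFinP.
exact: (measurableT_comp (measurable_powR p) (measurable_increment X s t)).
Qed.

(** The exponent [2 * r] turns the bound into a pure [p]-th power: [(L |t - s| ^ (2 r)) ^ (p / 2)]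
    is [(sqrt L |t - s| ^ r) ^ p]. *)
Lemma increment_moment_le (C0 iota L r : R) X (s t p : R) :
  0 <= C0 -> 0 <= L -> moments_growth C0 iota X ->
  second_moment_le L (2 * r) X -> s \in `[0, 1] -> t \in `[0, 1] -> s != t ->
  1 <= p ->
  (\int[P]_w (`|X t w - X s w| `^ p)%:E
     <= ((C0 * Num.sqrt L * p `^ iota * `|t - s| `^ r) `^ p)%:E)%E.
Proof.
move=> C00 L0 mX sX s01 t01 st p1.
have p0 : 0 <= p by rewrite (le_trans _ p1).
have := mX p s t p1 s01 t01; rewrite unlock => /le_trans; apply.
have := sX s t s01 t01 st; rewrite unlock.
under eq_integral do rewrite -real_normK ?num_real//.
set I := (\int[P]_w _)%E => hI.
have I0 : (0 <= I)%E by apply: integral_ge0 => w _; rewrite lee_fin exprn_ge0.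
have hI2 : (I `^ (p / 2) <= ((L * `|t - s| `^ (2 * r)) `^ (p / 2))%:E)%E.
  case: I hI I0 => [x| |]; rewrite ?leye_eq// !lee_fin => hx x0.
  by apply: ge0_ler_powR => //; rewrite ?divr_ge0// nnegrE (le_trans x0).
apply: (le_trans (lee_wpmul2l _ hI2)).
  by rewrite lee_fin mulr_ge0// powR_ge0.
rewrite -EFinM lee_fin le_eqVlt; apply/orP; left; apply/eqP.
rewrite !powRM ?mulr_ge0 ?powR_ge0 ?sqrtr_ge0// -!powRrM.
rewrite -(powR12_sqrt L0) -powRrM (mulrC iota).
have -> : 2 * r * (p / 2) = r * p by field.
have -> : p / 2 = 2^-1 * p by rewrite mulrC.
ring.
Qed.

Lemma ae_of_probability_eq1 (A : set T) : measurable A -> P A = 1%E ->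
  {ae P, forall w, A w}.
Proof.
move=> mA PA; apply/negligibleP; first exact: measurableC.
by have := probability_setC P mA; rewrite PA subee.
Qed.

Lemma probability_ae_eq1 (A : set T) : measurable A -> {ae P, forall w, A w} ->
  P A = 1%E.
Proof.
move=> mA /(measure_negligible (measurableC mA)).
move=> h0; have := probability_setC P mA; rewrite [X in X = _ -> _]h0 => /esym h.
have PA : P A \is a fin_num by rewrite fin_num_measure.
by move: h; rewrite -(fineK PA) -EFinB => -[] /eqP; rewrite subr_eq0 => /eqP <-.
Qed.

Lemma measurable_eq_RV (f g : {RV P >-> R}) : measurable [set w | f w = g w].
Proof.
rewrite -[X in measurable X]setTI.
have := @measurable_eqe _ T R setT measurableT (EFin \o f) (EFin \o g).
rewrite (_ : [set x | (EFin \o f) x = (EFin \o g) x] = [set w | f w = g w]).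
  by apply; apply/measurable_EFinP.
by apply/seteqP; split => w /= => [[]|->].
Qed.

Lemma modification_ae X Y : modification X Y -> forall t : R, t \in `[0, 1] ->
  {ae P, forall w, Y t w = X t w}.
Proof.
by move=> XY t t01; apply: ae_of_probability_eq1 (XY t t01); exact: measurable_eq_RV.
Qed.

Lemma modification_sym X Y : modification X Y -> modification Y X.
Proof.
by move=> XY t /XY <-; congr (P _); apply/seteqP; split => w /= ->.
Qed.

(** At fixed times the increments of [X] and [Y] agree almost surely. With [phi] nonnegative the
    comparison also covers infinite expectations; it carries the moment conditions over to
    modifications. *)
Lemma modification_expectation X Y (phi : R -> R) : modification X Y ->
  measurable_fun setT phi -> (forall x, 0 <= phi x) ->
  forall s t : R, s \in `[0, 1] -> t \in `[0, 1] ->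
  ('E_P[fun w => phi (Y t w - Y s w)%R] =
   'E_P[fun w => phi (X t w - X s w)%R])%E.
Proof.
move=> XY mphi phi0 s t s01 t01; rewrite unlock.
have mE (Z : R -> {RV P >-> R}) :
    measurable_fun setT (fun w => (phi (Z t w - Z s w))%:E).
  apply/measurable_EFinP; apply: (measurableT_comp mphi); exact: measurable_funB.
apply: ge0_ae_eq_integral => //.
- by move=> w _; rewrite lee_fin.
- by move=> w _; rewrite lee_fin.
- apply: filterS2 (modification_ae XY s01) (modification_ae XY t01).
  by move=> w /= -> ->.
Qed.

Lemma modification_increments_L2 X Y : modification X Y ->
  increments_L2 X -> increments_L2 Y.
Proof.
move=> XY hX s t s01 t01.
have m2 : measurable_fun setT (fun x : R => x ^+ 2) by exact: measurable_funX.
rewrite (modification_expectation XY m2 _ s01 t01); first exact: hX.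
by move=> x; exact: sqr_ge0.
Qed.

Lemma modification_moments_growth C0 iota X Y : modification X Y ->
  moments_growth C0 iota X -> moments_growth C0 iota Y.
Proof.
move=> XY hX p s t p1 s01 t01.
have mn : measurable_fun setT (fun x : R => `|x|) by exact: normr_measurable.
rewrite (modification_expectation XY
  (measurableT_comp (measurable_powR p) mn) _ s01 t01); last first.
  by move=> x; exact: powR_ge0.
rewrite (modification_expectation XY (measurable_funX 2 mn) _ s01 t01).
  exact: hX.
by move=> x; exact: exprn_ge0.
Qed.

Lemma modification_second_moment_le K r X Y : modification X Y ->
  second_moment_le K r X -> second_moment_le K r Y.
Proof.
move=> XY hX s t s01 t01 st.
have m2 : measurable_fun setT (fun x : R => x ^+ 2) by exact: measurable_funX.
rewrite (modification_expectation XY m2 _ s01 t01); first exact: hX.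
by move=> x; exact: sqr_ge0.
Qed.

End increments.

(** * From Hölder paths to second moments *)

Section holder_second_moment.
Context d (T : measurableType d) (R : realType) (P : probability T R).

Lemma probability_tail_le (C : {RV P >-> \bar R}) (eta : R) : 0 < eta ->
  {ae P, forall w, (C w < +oo)%E} ->
  exists n : nat, (P [set w | (n%:R%:E <= C w)%E] <= eta%:E)%E.
Proof.
move=> eta0 Cfin; pose F n := [set w | (n%:R%:E <= C w)%E].
have mF n : measurable (F n).
  rewrite -[X in measurable X]setTI.
  exact: (emeasurable_fun_c_infty measurableT (measurable_funPT C)).
have mI : measurable (\bigcap_n F n) by exact: bigcapT_measurable.
have PI : P (\bigcap_n F n) = 0%E.
  apply: measure_negligible => //; apply: negligibleS Cfin.
  move=> w wF /= Cw; have := wF (Num.truncn (fine (C w))).+1 I.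
  by rewrite /F /=; case: (C w) Cw => // r _; rewrite lee_fin leNgt truncnS_gt.
have cvF : (P \o F) @ \oo --> P (\bigcap_n F n).
  apply: nonincreasing_cvg_mu => //.
  - by rewrite (le_lt_trans (probability_le1 _ _))// ltry.
  - move=> m n mn; apply/subsetPset => w; rewrite /F /=; apply: le_trans.
    by rewrite lee_fin ler_nat.
rewrite PI in cvF.
have := cvF; move=> /fine_cvgP[_ /cvgr0Pnorm_le /(_ _ eta0)][n _ hn].
exists n; have := hn n (leqnn n); rewrite /= ger0_norm ?fine_ge0// => h.
by rewrite -(fineK (fin_num_measure P _ (mF n))) lee_fin.
Qed.

(** In the spirit of Paley and Zygmund: a fourth moment comparable with the squared second moment
    keeps [Z ^ 2] from concentrating on an event of small probability. *)
Lemma second_moment_truncated (Z : T -> R) (A : set T) (m B x : R) :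
  measurable_fun setT Z -> measurable A -> 0 <= m -> 0 < B -> 0 < x ->
  (\int[P]_w (Z w ^+ 2)%:E = x%:E)%E ->
  (\int[P]_w (Z w ^+ 4)%:E <= (B * x ^+ 2)%:E)%E ->
  (P A <= ((2 * B)^-1)%:E)%E ->
  {ae P, forall w, ~ A w -> Z w ^+ 2 <= m} ->
  x <= 4 * m.
Proof.
move=> mZ mA m0 B0 x0 Z2 Z4 PA hm.
(* On [A], where [Z] may be large, [Z^2 <= l Z^4 + c] by Young's inequality;
   the weights make both expectations at most fractions of [E Z^2]. *)
pose l := (2 * B * x)^-1; pose c := B * x / 2.
have l0 : 0 < l by rewrite invr_gt0 !mulr_gt0.
have c0 : 0 < c by rewrite divr_gt0 ?mulr_gt0.
have lc : 4 * (l * c) = 1 by rewrite /l /c; field; rewrite !gt_eqF.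
have mZ4 : measurable_fun setT (fun w => (Z w ^+ 4)%:E).
  by apply/measurable_EFinP; exact: measurable_funX.
have mI : measurable_fun setT (fun w => (\1_A w : R)%:E).
  by apply/measurable_EFinP.
have : (\int[P]_w (Z w ^+ 2)%:E <=
    \int[P]_w (m%:E + (l%:E * (Z w ^+ 4)%:E + c%:E * (\1_A w)%:E)))%E.
  apply: ae_ge0_le_integral => //.
  - by move=> w _; rewrite lee_fin sqr_ge0.
  - by apply/measurable_EFinP; exact: measurable_funX.
  - move=> w _; rewrite !adde_ge0// ?mule_ge0// ?lee_fin//; first exact: ltW.
    by rewrite (exprM _ 2 2) sqr_ge0.
    exact: ltW.
  - apply: emeasurable_funD => //; apply: emeasurable_funD.
      exact: measurable_funeM.
    exact: measurable_funeM.
  apply: filterS hm => w hw _; rewrite -!EFinM -!EFinD lee_fin.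
  have z4 : 0 <= Z w ^+ 4 by rewrite (exprM _ 2 2) sqr_ge0.
  rewrite indicE; case: (boolP (w \in A)) => wA.
    have : 0 <= (2 * l * Z w ^+ 2 - 1) ^+ 2 by exact: sqr_ge0.
    have -> : (2 * l * Z w ^+ 2 - 1) ^+ 2 =
      4 * l * (l * Z w ^+ 4 + c - Z w ^+ 2) + (1 - 4 * (l * c)).
      by ring.
    rewrite lc subrr addr0 pmulr_rge0 ?mulr_gt0// subr_ge0 mulr1.
    move=> h; rewrite (le_trans h)// lerDr//.
  rewrite mulr0 addr0 (le_trans (hw _))//; first by move/mem_set; apply/negP.
  by rewrite lerDl mulr_ge0// ltW.
rewrite ge0_integralD//; last 2 first.
- move=> w _; rewrite !adde_ge0// ?mule_ge0// ?lee_fin//; first exact: ltW.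
  by rewrite (exprM _ 2 2) sqr_ge0.
  exact: ltW.
- apply: emeasurable_funD; exact: measurable_funeM.
rewrite ge0_integralD//; last 4 first.
- move=> w _; rewrite mule_ge0// lee_fin; first exact: ltW.
  by rewrite (exprM _ 2 2) sqr_ge0.
- exact: measurable_funeM.
- by move=> w _; rewrite mule_ge0// lee_fin// ltW.
- exact: measurable_funeM.
rewrite ge0_integralZl//; last 2 first.
- by move=> w _; rewrite lee_fin (exprM _ 2 2) sqr_ge0.
- by rewrite lee_fin ltW.
rewrite ge0_integralZl//; last by rewrite lee_fin ltW.
rewrite integral_indic// setIT integral_cst//= probability_setT mule1 Z2.
move=> h; have : (x%:E <= m%:E + (l%:E * (B * x ^+ 2)%:E + c%:E * ((2 * B)^-1)%:E))%E.
  apply: (le_trans h); by rewrite leeD2l// leeD// lee_wpmul2l// lee_fin ltW.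
rewrite -!EFinM -!EFinD lee_fin.
(* The two contributions of [A] add up to [3 x / 4], leaving [x / 4 <= m]. *)
have -> : l * (B * x ^+ 2) = x / 2.
  by rewrite /l; field; rewrite !gt_eqF.
have -> : c * (2 * B)^-1 = x / 4.
  by rewrite /c; field; rewrite !gt_eqF.
lra.
Qed.

Lemma holder_second_moment (C0 iota alpha : R) (Y : R -> {RV P >-> R}) :
  0 < C0 -> increments_L2 Y -> moments_growth C0 iota Y ->
  holder_paths alpha Y ->
  forall eps : R, 0 < eps ->
    exists K : R, 0 < K /\ second_moment_le K (2 * alpha - eps) Y.
Proof.
move=> C00 L2 mY hY eps eps0.
have [C [Cfin hC]] := hY (eps / 2) (divr_gt0 eps0 (ltr0Sn _ 1)).
(* The constant of the moment growth at [p = 4], where the right side is the squared second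
   moment. *)
pose B := C0 `^ 4 * 4 `^ (4 * iota).
have B0 : 0 < B by rewrite mulr_gt0// powR_gt0.
have B20 : 0 < (2 * B)^-1 by rewrite invr_gt0 mulr_gt0.
have [n hn] := probability_tail_le B20 Cfin.
pose A := [set w | (n%:R%:E <= C w)%E].
have mA : measurable A.
  rewrite -[X in measurable X]setTI.
  exact: (emeasurable_fun_c_infty measurableT (measurable_funPT C)).
(* The summand [1] keeps the constant positive when [n = 0]. *)
exists (4 * n%:R ^+ 2 + 1); split; first by rewrite ltr_wpDl// mulr_ge0// sqr_ge0.
move=> s t s01 t01 st; rewrite unlock.
have mD : measurable_fun setT (fun w => Y t w - Y s w) by exact: measurable_funB.
have I0 : (0 <= \int[P]_w ((Y t w - Y s w) ^+ 2)%:E)%E.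
  by apply: integral_ge0 => w _; rewrite lee_fin sqr_ge0.
have := L2 s t s01 t01; rewrite unlock.
case E : (\int[P]_w _)%E I0 => [x| |]//; rewrite lee_fin => x0 _.
have tau0 : 0 <= `|t - s| `^ (2 * alpha - eps) by exact: powR_ge0.
rewrite lee_fin; move: x0; rewrite le_eqVlt => /predU1P[<-|x0].
  by rewrite mulr_ge0// addr_ge0// mulr_ge0// sqr_ge0.
rewrite (@le_trans _ _ (4 * (n%:R ^+ 2 * `|t - s| `^ (2 * alpha - eps))))//; last first.
  by rewrite mulrA ler_wpM2r// lerDl.
apply: (second_moment_truncated mD mA _ B0 x0 E _ hn).
- by rewrite mulr_ge0// sqr_ge0.
- have := mY 4 s t _ s01 t01; rewrite unlock.
  under eq_integral do rewrite powR_mulrn//.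
  under [X in ((_ * X `^ _)%E)]eq_integral do rewrite real_normK ?num_real//.
  under eq_integral do rewrite -normrX ger0_norm ?(exprM _ 2 2) ?sqr_ge0//.
  under eq_integral do rewrite -exprM.
  rewrite E poweR_EFin (_ : 4 / 2 = 2%:R); last by field.
  by rewrite (@powR_mulrn _ x 2 (ltW x0)) -EFinM -/B; apply; lra.
- apply: filterS hC => w hw Aw.
  have Cn : (C w < n%:R%:E)%E by rewrite ltNge; apply/negP.
  have := hw s t s01 t01 st => h.
  have : `|Y t w - Y s w| <= n%:R * `|t - s| `^ (alpha - eps / 2).
    rewrite -lee_fin (le_trans h)// EFinM lee_wpmul2r// ?lee_fin ?powR_ge0//.
    exact: ltW.
  move=> /(lerXn2r 2); rewrite !nnegrE normr_ge0 mulr_ge0 ?powR_ge0//.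
  move=> /(_ isT isT); rewrite real_normK ?num_real// exprMn => /le_trans; apply.
  rewrite -(@powR_mulrn _ (_ `^ _) 2) ?powR_ge0// -powRrM.
  by have -> : (alpha - eps / 2) * 2 = 2 * alpha - eps by field.
Qed.

End holder_second_moment.

(** * Moments of the dyadic Hölder constant *)

(** Countability reduces the supremum to one over natural numbers; [i0] stands in for codes that
    decode to no index. *)
Lemma measurable_fun_ereal_sup d (T : measurableType d) (R : realType)
    (I : countType) (i0 : I) (F : I -> T -> \bar R) :
  (forall i, measurable_fun setT (F i)) ->
  measurable_fun setT (fun w => ereal_sup (range (F^~ w))).
Proof.
move=> mF.
have -> : (fun w => ereal_sup (range (F^~ w))) =
    (fun w => esups (fun k => F (odflt i0 (unpickle k)) w) 0%N).
  apply/funext => w; rewrite /esups /=; congr ereal_sup.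
  apply/seteqP; split=> [_ [i _ <-]|_ [k _ <-]].
    by exists (pickle i) => //=; rewrite pickleK.
  by exists (odflt i0 (unpickle k)).
exact: measurable_fun_esups.
Qed.

Section dyadic_sup.
Context d (T : measurableType d) (R : realType) (P : probability T R).
Variables (X : R -> {RV P >-> R}) (g : R).

(** This is the [g]-Hölder quotient of neighbours on the grid of mesh [2 ^ (- n)]. *)
Let dist n i w := (2 `^ g) ^+ n * `|X (i.+1%:R / 2 ^+ n) w - X (i%:R / 2 ^+ n) w|.

Let dist_ge0 n i w : 0 <= dist n i w.
Proof. by rewrite mulr_ge0// exprn_ge0// powR_ge0. Qed.

Let measurable_dist_powR n i p :
  measurable_fun setT (fun w => (dist n i w `^ p)%:E).
Proof.
apply/measurable_EFinP; apply: (measurableT_comp (measurable_powR p)).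
by apply: measurable_funM => //; exact: measurable_increment.
Qed.

(* [pseries p] dominates the p-th power of the supremum of all [dist n i],
   for every [p] simultaneously. *)
Let psum p n w := (\sum_(0 <= i < 2 ^ n) (dist n i w `^ p)%:E)%E.
Let pseries p w := (\sum_(0 <= n <oo) psum p n w)%E.

Let psum_ge0 p n w : (0 <= psum p n w)%E.
Proof. by apply: sume_ge0 => i _; rewrite lee_fin powR_ge0. Qed.

Let measurable_psum p n : measurable_fun setT (psum p n).
Proof. by apply: emeasurable_sum => i; exact: measurable_dist_powR. Qed.

(** With [a] the [p]-th power on the right, each of the [2 ^ n] terms at level [n] has expectation
    at most [a 2 ^ (- n p (r - g))], hence at most [a 4 ^ (- n)]. So level [n] contributes at most
    [a 2 ^ (- n)], and the levels sum to [2 a]. *)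
Let integral_pseries (C0 iota L r p : R) : 0 <= C0 -> 0 <= L ->
  moments_growth C0 iota X -> second_moment_le L (2 * r) X ->
  1 <= p -> 2 <= p * (r - g) ->
  (\int[P]_w pseries p w
    <= (2 * (C0 * Num.sqrt L * p `^ iota) `^ p)%:E)%E.
Proof.
move=> C00 L0 mX sX p1 prg.
rewrite integral_nneseries//.
set a := (_ `^ p).
have -> : 2 * a = a / (1 - 2^-1) by field.
have h2 : 0 <= (2^-1 : R) < 1.
  by rewrite invr_ge0 ler0n/= invf_lt1// ltr1n.
rewrite -geometric_nneseries//; apply: lee_nneseries.
  by move=> n _ _; apply: integral_ge0.
move=> n _; rewrite ge0_integral_sum//; last first.
  by move=> i w _; rewrite lee_fin powR_ge0.
have hi i : (0 <= i < 2 ^ n)%N ->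
    (\int[P]_w (dist n i w `^ p)%:E <= (a * ((2^-1) ^+ n) ^+ 2)%:E)%E.
  move=> /= ilt; have e0 : 0 < (2 : R) ^+ n by rewrite exprn_gt0.
  have dE : i.+1%:R / 2 ^+ n - i%:R / 2 ^+ n = (2 ^+ n)^-1 :> R.
    by rewrite -mulrBl -natr1 [_ + 1]addrC addrK mul1r.
  have ne : (i%:R / 2 ^+ n : R) != i.+1%:R / 2 ^+ n.
    by rewrite eq_sym -subr_eq0 dE invr_eq0 gt_eqF.
  have := increment_moment_le C00 L0 mX sX (dyadic_itv R (ltnW ilt))
    (dyadic_itv R ilt) ne p1.
  rewrite dE gtr0_norm ?invr_gt0// => hX.
  rewrite /dist; under eq_integral do
    rewrite powRM ?exprn_ge0 ?powR_ge0// EFinM.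
  rewrite ge0_integralZl//; last first.
    exact: measurable_increment_powR.
  apply: (le_trans (lee_wpmul2l _ hX)); first by rewrite lee_fin powR_ge0.
  rewrite -EFinM lee_fin powRM ?mulr_ge0 ?powR_ge0 ?sqrtr_ge0//.
  rewrite -/a mulrCA ler_wpM2l ?powR_ge0//.
  rewrite -powRM ?exprn_ge0 ?powR_ge0//.
  have -> : (2 `^ g) ^+ n * (2 ^+ n)^-1 `^ r = 2 `^ (- (n%:R * (r - g))).
    rewrite -(@powR_mulrn _ 2 n)// -powRN -(@powR_mulrn _ (2 `^ g)) ?powR_ge0//.
    rewrite -!powRrM -powRD ?pnatr_eq0 ?implybT//.
    by congr (_ `^ _); ring.
  rewrite -powRrM -exprM exprVn -(@powR_mulrn _ 2 (n * 2))// -powRN.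
  rewrite ler_powR ?ler1n// mulNr lerN2 natrM -mulrA ler_wpM2l//.
  by rewrite mulrC.
rewrite big_nat.
apply: (@le_trans _ _ (\sum_(0 <= i < 2 ^ n | (0 <= i < 2 ^ n)%N)
    (a * ((2^-1) ^+ n) ^+ 2)%:E)%E); first exact: lee_sum.
rewrite -big_nat sumEFin lee_fin sumr_const_nat subn0 -[_ *+ _]mulr_natr natrX.
rewrite -mulrA ler_wpM2l ?powR_ge0// expr2 -mulrA -exprMn mulVf ?pnatr_eq0//.
by rewrite expr1n mulr1.
Qed.

Let F (k : nat * nat) w : \bar R :=
  (if (k.2 < 2 ^ k.1)%N then dist k.1 k.2 w else 0)%:E.
Let S w := ereal_sup (range (F^~ w)).

Let S_ge0 w : (0 <= S w)%E.
Proof.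
apply: (@le_trans _ _ (F (0, 0)%N w)); last by apply: ereal_sup_ubound; exists (0, 0)%N.
by rewrite /F /= lee_fin.
Qed.

Let S_le_pseries p w (y : R) : 0 < p -> (pseries p w <= y%:E)%E ->
  (S w <= (y `^ p^-1)%:E)%E.
Proof.
move=> p0 hy; apply: ge_ereal_sup => _ [[n i] _ <-]; rewrite /F /=.
case: ifPn => ni; rewrite lee_fin ?powR_ge0//.
have : ((dist n i w `^ p)%:E <= y%:E)%E.
  apply: (le_trans _ hy).
  apply: (@le_trans _ _ (psum p n w)).
    rewrite /psum (bigD1_seq i) ?mem_index_iota ?iota_uniq//= leeDl//.
    by apply: sume_ge0 => j _; rewrite lee_fin powR_ge0.
  apply: (le_trans _ (nneseries_lim_ge n.+1 _)).
    by rewrite big_nat_recr//= leeDr// sume_ge0.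
  by move=> k _ _.
rewrite lee_fin => h.
have -> : dist n i w = (dist n i w `^ p) `^ p^-1.
  by rewrite -powRrM divff ?gt_eqF// powRr1.
apply: ge0_ler_powR; rewrite ?nnegrE ?powR_ge0 ?invr_ge0// ?(ltW p0)//.
by rewrite (le_trans _ h)// powR_ge0.
Qed.

(** Exponential moments require one [M] for all [p]: it is the supremum of the neighbour quotients,
    whose [p]-th power is dominated by [pseries p]. *)
Lemma dyadic_sup_moments (C0 iota L r : R) : 0 <= C0 -> 0 <= L ->
  moments_growth C0 iota X -> second_moment_le L (2 * r) X -> g < r ->
  exists M : T -> R, [/\ measurable_fun setT M, forall w, 0 <= M w,
    {ae P, forall w, dyadic_increments_le (X^~ w) (M w) (2 `^ (- g))} &
    exists p0, 1 <= p0 /\ forall p, p0 <= p ->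
      (\int[P]_w (M w `^ p)%:E
        <= (2 * (C0 * Num.sqrt L * p `^ iota) `^ p)%:E)%E].
Proof.
move=> C00 L0 mX sX gr.
have mS : measurable_fun setT S.
  apply: (measurable_fun_ereal_sup (0, 0)%N) => -[n i]; rewrite /F /=.
  case: (i < 2 ^ n)%N; last exact: measurable_cst.
  apply/measurable_EFinP; apply: measurable_funM => //.
  exact: measurable_increment.
have rg0 : 0 < r - g by rewrite subr_gt0.
(* The entry [1] is for the moment growth, the other one makes the expected level sums decay
   geometrically. *)
pose p0 := Num.max 1 (2 / (r - g)).
have hp p : p0 <= p -> 1 <= p /\ 2 <= p * (r - g).
  rewrite ge_max => /andP[-> h]; split => //.
  by rewrite -ler_pdivrMr.
have hint p : p0 <= p -> _ := fun pp =>
  integral_pseries C00 L0 mX sX (hp p pp).1 (hp p pp).2.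
have mps p : measurable_fun setT (pseries p).
  by apply: ge0_emeasurable_sum => // k _; exact: measurable_psum.
have ps0 p w : (0 <= pseries p w)%E by apply: nneseries_ge0.
have Sfin : {ae P, forall w, (S w < +oo)%E}.
  have : P.-integrable setT (pseries p0).
    apply/integrableP; split => //.
    under eq_integral do rewrite gee0_abs//.
    by rewrite (le_lt_trans (hint _ (lexx _)))// ltry.
  move=> /(integrable_ae measurableT); apply: filterS => w /(_ I) fw.
  rewrite (@le_lt_trans _ _ ((fine (pseries p0 w)) `^ p0^-1)%:E) ?ltry//.
  apply: S_le_pseries; last by rewrite fineK.
  by rewrite (lt_le_trans _ (hp _ (lexx _)).1).
(* [fine] turns an infinite supremum into 0, which happens on a null set only. *)
exists (fine \o S); split.
- exact: (measurableT_comp (fine_measurable measurableT) mS).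
- by move=> w; rewrite /= fine_ge0.
- apply: filterS Sfin => w Sw n i ni.
  have : (F (n, i) w <= S w)%E by apply: ereal_sup_ubound; exists (n, i).
  rewrite /F /= ni -(@fineK _ (S w)) ?ge0_fin_numE// lee_fin /dist => h.
  rewrite powRN exprVn ler_pdivlMr ?exprn_gt0 ?powR_gt0//.
  by rewrite mulrC.
exists p0; split; first by rewrite le_max lexx.
move=> p pp; apply: (le_trans _ (hint p pp)).
have pgt0 : 0 < p by rewrite (lt_le_trans _ (hp _ pp).1).
apply: ge0_le_integral => //.
- by move=> w _; rewrite lee_fin powR_ge0.
- apply/measurable_EFinP; apply: (measurableT_comp (measurable_powR p)).
  exact: (measurableT_comp (fine_measurable measurableT) mS).
move=> w _ /=.
have := ps0 p w; case E : (pseries p w) => [y| |]//; rewrite ?leey//.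
rewrite !lee_fin => y0.
have : (S w <= (y `^ p^-1)%:E)%E by apply: S_le_pseries => //; rewrite E.
have := S_ge0 w; case: (S w) => [x| |]//; rewrite !lee_fin /= => x0 xy.
rewrite (@le_trans _ _ ((y `^ p^-1) `^ p))//.
  by apply: ge0_ler_powR => //; rewrite ?nnegrE ?powR_ge0// ltW.
by rewrite -powRrM mulVf ?gt_eqF// powRr1.
Qed.

End dyadic_sup.

(** * Hölder continuous modification *)

Definition RV_of d (T : measurableType d) (R : realType) (P : probability T R)
    d' (T' : measurableType d') (f : T -> T') (mf : measurable_fun setT f) :
    {RV P >-> T'} := mfun_Sub (mem_set mf).

Section limits.
Context d (T : measurableType d) (R : realType) (P : probability T R).

(** By Fatou's lemma [E (Y - X) ^ 2] is at most the lower limit of [E (Z n - X) ^ 2], which is 0. *)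
Lemma L2_cvg_ae_eq (Z : nat -> {RV P >-> R}) (X Y : {RV P >-> R}) (e : R ^nat) :
  {ae P, forall w, (fun n => Z n w) @ \oo --> Y w} ->
  (forall n, (\int[P]_w ((Z n w - X w) ^+ 2)%:E <= (e n)%:E)%E) ->
  e @ \oo --> 0 ->
  {ae P, forall w, Y w = X w}.
Proof.
move=> ZY hZ e0.
pose f n w := ((Z n w - X w) ^+ 2)%:E.
have mf n : measurable_fun setT (f n).
  apply/measurable_EFinP; apply: measurable_funX; exact: measurable_funB.
have mD : measurable_fun setT (fun w => Y w - X w) by exact: measurable_funB.
have mg : measurable_fun setT (fun w => ((Y w - X w) ^+ 2)%:E).
  by apply/measurable_EFinP; exact: measurable_funX.
have f0 n w : (0 <= f n w)%E by rewrite lee_fin sqr_ge0.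
have cf : (fun n => \int[P]_w f n w)%E @ \oo --> 0%E.
  apply: (@squeeze_cvge _ _ _ _ (cst 0%E) _ (EFin \o e)).
  - by apply: nearW => n; apply/andP; split; [exact: integral_ge0|exact: hZ].
  - exact: cvg_cst.
  - by apply: cvg_EFin => //; exact: nearW.
have fatou_le := @fatou _ _ _ P setT measurableT f mf (fun n w _ => f0 n w).
rewrite (cvg_limn_einf_sup cf).1 in fatou_le.
have I0 : (\int[P]_w ((Y w - X w) ^+ 2)%:E = 0)%E.
  apply/eqP; rewrite eq_le integral_ge0/= ?andbT; last first.
    by move=> w _; rewrite lee_fin sqr_ge0.
  rewrite (le_trans _ fatou_le)// le_eqVlt; apply/orP; left; apply/eqP.
  apply: ae_eq_integral => //.
    rewrite /limn_einf; apply: measurableT_comp => //.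
    by apply: measurable_fun_limn_esup => n; exact: measurableT_comp.
  apply: filterS ZY => w Zw _.
  apply/esym; apply: (cvg_limn_einf_sup _).1.
  apply: cvg_EFin; first exact: nearW.
  rewrite /comp /f /=.
  by under eq_fun do rewrite /= expr2; rewrite expr2; apply: cvgM; apply: cvgB => //; exact: cvg_cst.
have : (\int[P]_w `|((Y w - X w) ^+ 2)%:E| = 0)%E.
  by rewrite -[RHS]I0; apply: eq_integral => w _; rewrite gee0_abs// lee_fin sqr_ge0.
move=> /(ae_eq_integral_abs P measurableT mg).
apply: filterS => w /(_ I) [] /eqP; rewrite sqrf_eq0 subr_eq0.
by move/eqP.
Qed.

End limits.

Section holder_modification.
Context d (T : measurableType d) (R : realType) (P : probability T R).

(** The upper limit is defined and measurable on the whole space, and is the limit along dyadic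
    points wherever that exists; so no null set has to be removed. *)
Lemma dyadic_point_RV (X : R -> {RV P >-> R}) (t : R) :
  measurable_fun setT
    (fun w => fine (limn_esup (fun n => (X (dyadic_point n t) w)%:E))).
Proof.
apply: (measurableT_comp (fine_measurable measurableT)).
by apply: measurable_fun_limn_esup => n; apply/measurable_EFinP.
Qed.

Lemma holder_modification (C0 iota alpha : R) (X : R -> {RV P >-> R}) :
  0 < C0 -> 0 < alpha -> moments_growth C0 iota X ->
  (forall eps : R, 0 < eps -> exists K : R,
        0 < K /\ second_moment_le K (2 * alpha - eps) X) ->
  exists Y : R -> {RV P >-> R}, modification X Y /\ holder_paths alpha Y.
Proof.
move=> C00 a0 mX hX.
pose Y t : {RV P >-> R} := RV_of P (dyadic_point_RV X t).
exists Y.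
have hM g : 0 < g < alpha -> exists M : T -> R,
    [/\ measurable_fun setT M, forall w, 0 <= M w &
    {ae P, forall w, dyadic_increments_le (X^~ w) (M w) (2 `^ (- g))}].
  move=> /andP[g0 ga].
  (* The loss [alpha - g] puts the exponent [r] midway between [g] and [alpha]. *)
  have [|K [K0 hK]] := hX (alpha - g); first by rewrite subr_gt0.
  have gr : g < (alpha + g) / 2 by lra.
  have sX : second_moment_le K (2 * ((alpha + g) / 2)) X.
    by have -> : 2 * ((alpha + g) / 2) = 2 * alpha - (alpha - g) by field.
  have [M [mM M0 hM _]] := dyadic_sup_moments (ltW C00) (ltW K0) mX sX gr.
  by exists M.
have hY g M w : 0 < g -> 0 <= M ->
    dyadic_increments_le (X^~ w) M (2 `^ (- g)) ->
    forall t : R, t \in `[0, 1] ->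
    (fun n => X (dyadic_point n t) w) @ \oo --> Y t w.
  move=> g0 M0 XM t t01.
  have /cvg_ex[l hl] : cvgn (fun n => X (dyadic_point n t) w).
    exact: (is_cvg_dyadic_point M0 (powR_gt0 _ _) (powR2N_lt1 g0) XM t01).
  have : (fun n => (X (dyadic_point n t) w)%:E) @ \oo --> l%:E.
    by apply: cvg_EFin => //; exact: nearW.
  by move=> /cvg_limn_einf_sup[_]; rewrite /Y /= => ->.
have a2 : 0 < alpha / 2 < alpha by apply/andP; split; lra.
split.
  have [M [mM M0 XM]] := hM _ a2.
  move=> t t01; apply: probability_ae_eq1; first exact: measurable_eq_RV.
  (* With loss [alpha] the second moment is at most [K |t - s| ^ alpha], so the error of rounding
     tends to 0 geometrically. *)
  have [K [K0 hK]] := hX alpha a0.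
  have E : 2 * alpha - alpha = alpha by ring.
  rewrite E in hK.
  apply: (@L2_cvg_ae_eq _ _ _ _ (fun n => X (dyadic_point n t)) _ _
    (geometric K (2 `^ (- alpha)))).
  - by apply: filterS XM => w XMw; apply: hY XMw t t01 => //; lra.
  - move=> n; have [->|ne] := eqVneq (dyadic_point n t) t.
      under eq_integral do rewrite subrr expr0n.
      by rewrite integral0 lee_fin mulr_ge0 ?exprn_ge0 ?powR_ge0// ltW.
    have := hK _ _ t01 (dyadic_point_itv n t01).
    rewrite eq_sym unlock => /(_ ne) /le_trans; apply.
    rewrite lee_fin /= ler_wpM2l ?(ltW K0)// distrC.
    rewrite powR2N_expr.
    apply: ge0_ler_powR; rewrite ?nnegrE ?invr_ge0 ?exprn_ge0 ?(ltW a0)//.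
    apply: dyadic_point_dist.
    by move: t01; rewrite in_itv /= => /andP[].
  - by apply: cvg_geometric; rewrite ger0_norm ?powR_ge0// powR2N_lt1.
move=> eps eps0.
(* [alpha - eps] may be nonpositive while chaining needs a positive exponent; on [[0, 1]] a bound of
   larger order implies the wanted one. *)
pose g := Num.max (alpha - eps) (alpha / 2).
have g0 : 0 < g by rewrite lt_max; apply/orP; right; lra.
have ga : g < alpha by rewrite gt_max; apply/andP; split; lra.
have [|M [mM M0 XM]] := hM g; first by rewrite g0.
pose c : R := 2 `^ g * (1 + 2 * (1 - 2 `^ (- g))^-1).
have mC : measurable_fun setT (fun w => (c * M w)%:E).
  by apply/measurable_EFinP; exact: measurable_funM.
exists (RV_of P mC); split; first by apply: aeW => w /=; rewrite ltry.
apply: filterS XM => w XMw s t s01 t01 st /=.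
rewrite -EFinM lee_fin.
have := dyadic_increments_holder (M0 w) g0 XMw (hY _ _ _ g0 (M0 w) XMw) s01 t01.
move=> /le_trans; apply; rewrite ler_wpM2l//.
  rewrite mulr_ge0// mulr_ge0 ?powR_ge0// addr_ge0// mulr_ge0// invr_ge0.
  by rewrite subr_ge0 ltW// powR2N_lt1.
apply: ger_powR; last by rewrite le_max lexx.
by rewrite normr_gt0 subr_eq0 eq_sym st dist01_le1.
Qed.

End holder_modification.

(** * Hölder quotients *)

(* On the diagonal the quotient is 0, whatever the junk value of [0 `^ g]. *)
Definition holder_quotient (R : realType) (g : R) (y : R -> R) (s t : R) : R :=
  `|y t - y s| / `|t - s| `^ g.

Section holder_quotient.
Variable R : realType.
Implicit Types (y : R -> R) (g s t : R).

Lemma holder_quotient_ge0 g y s t : 0 <= holder_quotient g y s t.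
Proof. by rewrite divr_ge0// powR_ge0. Qed.

Lemma holder_quotientxx g y t : holder_quotient g y t t = 0.
Proof. by rewrite /holder_quotient subrr normr0 mul0r. Qed.

Lemma continuous_powR_gt0 g (x : R) : 0 < x ->
  {for x, continuous (fun a : R => a `^ g)}.
Proof.
move=> x0; apply: differentiable_continuous; apply/derivable1_diffP.
by apply: derivable_powR; rewrite in_itv /= x0.
Qed.

Lemma cvg_holder_quotient g y s t (u v : R ^nat) : s != t ->
  u @ \oo --> s -> v @ \oo --> t ->
  (fun n => y (u n)) @ \oo --> y s -> (fun n => y (v n)) @ \oo --> y t ->
  (fun n => holder_quotient g y (u n) (v n)) @ \oo --> holder_quotient g y s t.
Proof.
move=> st us vt yu yv.
have ts0 : 0 < `|t - s| by rewrite normr_gt0 subr_eq0 eq_sym.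
apply: cvgM; first by apply: cvg_norm; exact: cvgB.
apply: cvgV; first by rewrite gt_eqF// powR_gt0.
apply: (@cvg_comp _ _ _ (fun n => `|v n - u n|) (fun a : R => a `^ g)).
  by apply: cvg_norm; exact: cvgB vt us.
exact: continuous_powR_gt0.
Qed.

(** The sign of [g] is arbitrary: [b <= 2 * a] serves [g >= 0], and [a / 2 <= b] serves [g < 0]. *)
Lemma powR_ratio_le g (a b : R) : 0 < a -> a / 2 <= b <= 2 * a ->
  (a `^ g)^-1 <= 2 `^ `|g| * (b `^ g)^-1.
Proof.
move=> a0 /andP[ab ba].
have b0 : 0 < b by rewrite (lt_le_trans _ ab)// divr_gt0.
rewrite ler_pdivlMr ?powR_gt0// mulrC ler_pdivrMr ?powR_gt0//.
have [g0|g0] := leP 0 g.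
  by rewrite ger0_norm// -powRM// ?(ltW a0)// ge0_ler_powR ?nnegrE ?mulr_ge0 ?(ltW a0) ?(ltW b0).
rewrite -(opprK g) (powRN b) (powRN a) normrN (gtr0_norm (_ : 0 < - g)) ?oppr_gt0//.
rewrite ler_pdivlMr ?powR_gt0// mulrC ler_pdivrMr ?powR_gt0//.
rewrite -powRM// ?(ltW b0)// ge0_ler_powR ?nnegrE ?mulr_ge0 ?(ltW a0) ?(ltW b0)//.
  by rewrite oppr_ge0 ltW.
by rewrite -ler_pdivrMl// mulrC.
Qed.

Lemma dyadic_point_cvg t : t \in `[0, 1] ->
  (fun n => dyadic_point n t) @ \oo --> t.
Proof.
move=> t01; have t0 : 0 <= t by move: t01; rewrite in_itv /= => /andP[].
apply/cvgrPdist_le => e e0.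
have /cvgr0Pnorm_le /(_ _ e0) : geometric 1 (2^-1 : R) @ \oo --> 0.
  by apply: cvg_geometric; rewrite gtr0_norm ?invr_gt0// invf_lt1// ltr1n.
apply: filterS => n /=; rewrite mul1r exprVn ger0_norm ?invr_ge0 ?exprn_ge0//.
by apply: le_trans; exact: dyadic_point_dist.
Qed.

(** [theta] is the surplus of regularity: the error is a multiple of [m] that vanishes with the
    mesh, while the main term involves only finitely many grid quotients. *)
Lemma holder_quotient_le (g h theta m : R) y n s t :
  0 <= m -> 0 < theta -> theta <= h - g -> theta <= h ->
  (forall s t : R, s \in `[0, 1] -> t \in `[0, 1] ->
     `|y t - y s| <= m * `|t - s| `^ h) ->
  s \in `[0, 1] -> t \in `[0, 1] -> s != t ->
  holder_quotient g y s t <=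
    2 `^ `|g| * holder_quotient g y (dyadic_point n s) (dyadic_point n t)
    + 2 `^ (1 + theta) * m * (2 `^ (- theta)) ^+ n.
Proof.
move=> m0 th0 thg thh hy s01 t01 st.
set e : R := (2 ^+ n)^-1.
have e0 : 0 < e by rewrite invr_gt0 exprn_gt0.
have e1 : e <= 1 by rewrite invf_le1 ?exprn_gt0// exprn_ege1// ler1n.
have d0 : 0 < `|t - s| by rewrite normr_gt0 subr_eq0 eq_sym.
have d1 : `|t - s| <= 1 by exact: dist01_le1.
have d01 : 0 < `|t - s| <= 1 by rewrite d0.
rewrite powR2N_expr -/e.
have q0 := holder_quotient_ge0 g y (dyadic_point n s) (dyadic_point n t).
(* Increments shorter than two meshes are controlled by the better exponent
   [h]; for longer ones, moving the endpoints to the grid changes the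
   distance by a factor at most 2. *)
have [de|de] := leP `|t - s| (2 * e).
  rewrite (@le_trans _ _ (2 `^ (1 + theta) * m * e `^ theta))//; last first.
    by rewrite lerDr mulr_ge0// powR_ge0.
  rewrite /holder_quotient ler_pdivrMr ?powR_gt0//.
  rewrite (le_trans (hy _ _ s01 t01))//.
  have -> : 2 `^ (1 + theta) * m * e `^ theta * `|t - s| `^ g =
    m * (2 * (2 * e) `^ theta * `|t - s| `^ g).
    rewrite powRD ?pnatr_eq0 ?implybT// powRr1// powRM ?(ltW e0)//; ring.
  rewrite ler_wpM2l//.
  rewrite (@le_trans _ _ (`|t - s| `^ theta * `|t - s| `^ g))//.
    rewrite -powRD ?(gt_eqF d0) ?implybT//; apply: ger_powR => //; lra.
  rewrite ler_wpM2r ?powR_ge0//.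
  rewrite (@le_trans _ _ ((2 * e) `^ theta))//.
    by rewrite ge0_ler_powR ?nnegrE ?(ltW th0) ?mulr_ge0 ?(ltW e0).
  by rewrite ler_peMl ?powR_ge0// ler1n.
move: (s01) (t01); rewrite !in_itv /= => /andP[s0 s1] /andP[t0 t1].
set u := dyadic_point n s; set v := dyadic_point n t.
have /andP[us1 us2] := dyadic_point_le n s0; rewrite -/u -/e in us1 us2.
have /andP[vt1 vt2] := dyadic_point_le n t0; rewrite -/v -/e in vt1 vt2.
have u01 : u \in `[0, 1] by exact: dyadic_point_itv.
have v01 : v \in `[0, 1] by exact: dyadic_point_itv.
(* Both rounding errors lie in [[0, e)], so the distance changes by at most [e], which is below
   [|t - s| / 2]. *)
have ratio : `|t - s| / 2 <= `|v - u| <= 2 * `|t - s|.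
  have h1 : `|t - s| <= `|v - u| + e.
    rewrite -lerBlDl (le_trans (lerB_dist _ _))//; rewrite ler_norml; lra.
  have h2 : `|v - u| <= `|t - s| + e.
    rewrite -lerBlDl (le_trans (lerB_dist _ _))//; rewrite ler_norml; lra.
  by apply/andP; split; lra.
have split3 : `|y t - y s| <= `|y v - y u| + 2 * (m * e `^ h).
  have hu : `|y u - y s| <= m * e `^ h.
    rewrite (le_trans (hy _ _ s01 u01))// ler_wpM2l// ge0_ler_powR ?nnegrE//; first lra.
      exact: ltW.
    by rewrite ler_norml; lra.
  have hv : `|y t - y v| <= m * e `^ h.
    rewrite (le_trans (hy _ _ v01 t01))// ler_wpM2l// ge0_ler_powR ?nnegrE//; first lra.
      exact: ltW.
    by rewrite ler_norml; lra.
  rewrite (le_trans (ler_distD (y v) _ _))//.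
  have := ler_distD (y u) (y v) (y s); lra.
rewrite {1}/holder_quotient.
rewrite (le_trans (ler_wpM2r _ split3)) ?invr_ge0 ?powR_ge0// mulrDl lerD//.
  rewrite /holder_quotient mulrCA ler_wpM2l//.
  exact: powR_ratio_le.
(* [theta <= h] gives [e ^ (h - theta) <= |t - s| ^ (h - theta)], and [theta <= h - g] bounds the
   latter by [|t - s| ^ g]. *)
have hg : e `^ h / `|t - s| `^ g <= e `^ theta.
  rewrite ler_pdivrMr ?powR_gt0//.
  rewrite (@le_trans _ _ (e `^ theta * e `^ (h - theta)))//.
    by rewrite -powRD ?(gt_eqF e0) ?implybT// addrC subrK.
  rewrite ler_wpM2l ?powR_ge0//.
  rewrite (@le_trans _ _ (`|t - s| `^ (h - theta)))//.
    rewrite ge0_ler_powR ?nnegrE ?(ltW e0)//; first by lra.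
    by rewrite (le_trans _ (ltW de))// ler_peMl ?ler1n// ltW.
  by apply: ger_powR => //; lra.
rewrite -mulrA -mulrA.
rewrite (@le_trans _ _ (2 * (m * e `^ theta)))//.
  by rewrite ler_wpM2l// -mulrA ler_wpM2l.
rewrite ler_wpM2r ?mulr_ge0 ?powR_ge0//.
by rewrite -[leLHS](powRr1 (ler0n R 2)) ler_powR ?ler1n// lerDl ltW.
Qed.

End holder_quotient.

(** * Exponential integrability of the Hölder constant *)

Section holder_constant.
Context d (T : measurableType d) (R : realType) (P : probability T R).
Variables (Y : R -> {RV P >-> R}) (g : R).

Lemma measurable_holder_quotient (s t : R) :
  measurable_fun setT (fun w => holder_quotient g (Y^~ w) s t).
Proof. by apply: measurable_funM => //; exact: measurable_increment. Qed.

Definition dyadic_quotient (k : nat * nat * nat) (w : T) : R :=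
  let: (n, i, j) := k in
  if (i <= 2 ^ n)%N && (j <= 2 ^ n)%N then
    holder_quotient g (Y^~ w) (i%:R / 2 ^+ n) (j%:R / 2 ^+ n) else 0.

(** [holder_const] is an uncountable supremum; this countable version is measurable and agrees with
    it on paths that are continuous along dyadic roundings. *)
Definition dyadic_holder_const (w : T) : \bar R :=
  ereal_sup (range (fun k => (dyadic_quotient k w)%:E)).

Lemma measurable_dyadic_holder_const : measurable_fun setT dyadic_holder_const.
Proof.
apply: (measurable_fun_ereal_sup (0, 0, 0)%N) => -[[n i] j] /=.
apply/measurable_EFinP; case: (_ && _); last exact: measurable_cst.
exact: measurable_holder_quotient.
Qed.

Lemma holder_quotient_le_const (w : T) (s t : R) :
  s \in `[0, 1] -> t \in `[0, 1] -> s != t ->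
  ((holder_quotient g (Y^~ w) s t)%:E <= holder_const g Y w)%E.
Proof. by move=> s01 t01 st; apply: ereal_sup_ubound; exists s, t. Qed.

Lemma holder_const_ge0 (w : T) : (0 <= holder_const g Y w)%E.
Proof.
apply: (@le_trans _ _ (holder_quotient g (Y^~ w) 0 1)%:E).
  by rewrite lee_fin holder_quotient_ge0.
by apply: holder_quotient_le_const; rewrite ?in_itv /= ?lexx ?ler01 // eq_sym oner_neq0.
Qed.

Lemma holder_const_le (w : T) (x : R) :
  (forall s t : R, s \in `[0, 1] -> t \in `[0, 1] -> s != t ->
    holder_quotient g (Y^~ w) s t <= x) ->
  (holder_const g Y w <= x%:E)%E.
Proof.
move=> hx; apply: ge_ereal_sup => _ [s [t [s01 t01 st ->]]].
by rewrite lee_fin; exact: hx.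
Qed.

(** Rounding [s] and [t] at a common level gives grid quotients that converge to the one at [s] and
    [t]. *)
Lemma holder_const_dyadicE (w : T) :
  (forall t : R, t \in `[0, 1] ->
     (fun n => Y (dyadic_point n t) w) @ \oo --> Y t w) ->
  holder_const g Y w = dyadic_holder_const w.
Proof.
move=> Yc; apply/eqP; rewrite eq_le; apply/andP; split.
  apply: ge_ereal_sup => _ [s [t [s01 t01 st ->]]].
  case E : (dyadic_holder_const w) => [x| |].
  - rewrite lee_fin; apply: (@cvgr_to_le _ \oo _ _ (fun n =>
      holder_quotient g (Y^~ w) (dyadic_point n s) (dyadic_point n t))).
      by apply: cvg_holder_quotient => //; by [exact: dyadic_point_cvg|exact: Yc].
    apply: nearW => n; rewrite -lee_fin -E; apply: ereal_sup_ubound.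
    exists (n, Num.truncn (2 ^+ n * s), Num.truncn (2 ^+ n * t)) => //=.
    by move: s01 t01; rewrite !in_itv /= => /andP[_ ?] /andP[_ ?]; rewrite !truncn_dyadic_le.
  - by rewrite leey.
  - have : ((dyadic_quotient (0, 0, 0)%N w)%:E <= dyadic_holder_const w)%E.
      by apply: ereal_sup_ubound; exists (0, 0, 0)%N.
    by rewrite E.
apply: ge_ereal_sup => _ [[[n i] j] _ <-] /=.
case: ifPn => [/andP[i2 j2]|_]; last exact: holder_const_ge0.
have [->|ij] := eqVneq (i%:R / 2 ^+ n : R) (j%:R / 2 ^+ n).
  by rewrite holder_quotientxx holder_const_ge0.
by apply: holder_quotient_le_const => //; exact: dyadic_itv.
Qed.

(** A uniform bound on the exponentials passes to the supremum by inverting the increasing map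
    [u -> exp (b u ^ k)] on nonnegative reals. *)
Lemma expR_holder_const_le (w : T) (x y b k : R) : 0 < b -> 0 < k ->
  x%:E = holder_const g Y w ->
  (forall s t : R, s \in `[0, 1] -> t \in `[0, 1] -> s != t ->
    expR (b * holder_quotient g (Y^~ w) s t `^ k) <= y) ->
  expR (b * x `^ k) <= y.
Proof.
move=> b0 k0 xE hy.
have x0 : 0 <= x by rewrite -lee_fin xE holder_const_ge0.
(* The pair [0], [1] yields this bound, which makes [ln y] nonnegative. *)
have y1 : 1 <= y.
  have st : (0 : R) != 1 by rewrite eq_sym oner_neq0.
  have := hy 0 1; rewrite !in_itv /= !lexx !ler01 => /(_ isT isT st); apply: le_trans.
  by rewrite -expR0 ler_expR mulr_ge0 ?powR_ge0// ltW.
have y0 : 0 < y by rewrite (lt_le_trans _ y1).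
have ly : 0 <= ln y / b by rewrite divr_ge0 ?ln_ge0// ltW.
have : x <= (ln y / b) `^ k^-1.
  rewrite -lee_fin xE; apply: holder_const_le => s t s01 t01 st.
  have q0 := holder_quotient_ge0 g (Y^~ w) s t.
  rewrite -[leLHS](powRr1 q0) -(@divff _ k) ?gt_eqF// powRrM.
  rewrite ge0_ler_powR ?nnegrE ?invr_ge0 ?powR_ge0 ?(ltW k0)//.
  rewrite ler_pdivlMr// mulrC -(expRK (_ * _)) ler_ln ?posrE ?expR_gt0//.
  exact: hy.
move=> /(ge0_ler_powR (ltW k0)); rewrite !nnegrE x0 powR_ge0 => /(_ isT isT).
rewrite -powRrM mulVf ?gt_eqF// powRr1// => h.
by rewrite -[leRHS](lnK y0) ler_expR mulrC -ler_pdivlMr.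
Qed.

(** As [g <= r] and distances are at most 1, the bound is uniform in [s] and [t], hence in the mesh
    of a grid. *)
Lemma holder_quotient_moment_le (C0 iota K r k : R) (s t p : R) :
  0 <= C0 -> 0 <= K -> 0 <= k -> g <= r ->
  moments_growth C0 iota Y -> second_moment_le K (2 * r) Y ->
  s \in `[0, 1] -> t \in `[0, 1] -> 1 <= p ->
  (\int[P]_w ((k * holder_quotient g (Y^~ w) s t) `^ p)%:E
    <= ((k * (C0 * Num.sqrt K) * p `^ iota) `^ p)%:E)%E.
Proof.
move=> C00 K0 k0 gr mY sY s01 t01 p1.
have p0 : 0 < p by rewrite (lt_le_trans _ p1).
have [<-|st] := eqVneq s t.
  under eq_integral do rewrite holder_quotientxx mulr0 powR0 ?gt_eqF//.
  by rewrite integral0 lee_fin powR_ge0.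
have d0 : 0 < `|t - s| by rewrite normr_gt0 subr_eq0 eq_sym.
pose c := k / `|t - s| `^ g.
have c0 : 0 <= c by rewrite divr_ge0// powR_ge0.
have E w : k * holder_quotient g (Y^~ w) s t = c * `|Y t w - Y s w|.
  by rewrite /holder_quotient mulrA mulrAC.
under eq_integral do rewrite E powRM// EFinM.
rewrite ge0_integralZl//; last 2 first.
- exact: measurable_increment_powR.
- by rewrite lee_fin powR_ge0.
apply: (le_trans (lee_wpmul2l _ (increment_moment_le C00 K0 mY sY s01 t01 st p1))).
  by rewrite lee_fin powR_ge0.
have b0 : 0 <= C0 * Num.sqrt K * p `^ iota.
  by rewrite mulr_ge0 ?powR_ge0// mulr_ge0 ?sqrtr_ge0.
rewrite -EFinM lee_fin -powRM ?mulr_ge0 ?powR_ge0 ?sqrtr_ge0//.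
rewrite ge0_ler_powR ?nnegrE ?(ltW p0)//; first by rewrite !mulr_ge0 ?powR_ge0 ?sqrtr_ge0.
  by rewrite !mulr_ge0 ?powR_ge0 ?sqrtr_ge0.
have -> : c * (C0 * Num.sqrt K * p `^ iota * `|t - s| `^ r) =
    k * (C0 * Num.sqrt K) * p `^ iota * `|t - s| `^ (r - g).
  by rewrite powRB ?(gt_eqF d0) ?implybT// /c; ring.
rewrite ler_piMr//; first by rewrite -mulrA mulr_ge0.
rewrite -(powRr0 `|t - s|); apply: ger_powR; last by rewrite subr_ge0.
by rewrite d0 dist01_le1.
Qed.

End holder_constant.

(** * Exponential moments through a finite dyadic grid *)

Section exponential_integrability.
Context d (T : measurableType d) (R : realType) (P : probability T R).

Lemma holder_paths_dyadic_cvg (alpha : R) (Y : R -> {RV P >-> R}) :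
  0 < alpha -> holder_paths alpha Y ->
  {ae P, forall w, forall t : R, t \in `[0, 1] ->
     (fun n => Y (dyadic_point n t) w) @ \oo --> Y t w}.
Proof.
move=> a0 hY; have a2 : 0 < alpha / 2 by rewrite divr_gt0.
have [C [Cfin hC]] := hY (alpha / 2) a2.
have aE : alpha - alpha / 2 = alpha / 2 by field.
apply: filterS2 Cfin hC => w Cw hw t t01.
have t0 : 0 <= t by move: t01; rewrite in_itv /= => /andP[].
have c0 := normr_ge0 (fine (C w)); set c := `|fine (C w)| in c0.
apply/cvgrPdist_le => e e0.
have : geometric c (2 `^ (- (alpha / 2))) @ \oo --> 0.
  by apply: cvg_geometric; rewrite ger0_norm ?powR_ge0// powR2N_lt1.
move=> /cvgr0Pnorm_le /(_ _ e0); apply: filterS => n /=.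
rewrite ger0_norm ?mulr_ge0 ?exprn_ge0 ?powR_ge0//; apply: le_trans.
have [->|ne] := eqVneq (dyadic_point n t) t.
  by rewrite subrr normr0 mulr_ge0 ?exprn_ge0 ?powR_ge0.
have := hw _ _ (dyadic_point_itv n t01) t01 ne; rewrite aE.
set x := `|t - _| `^ _ => h.
have x0 : 0 < x by rewrite powR_gt0// normr_gt0 subr_eq0 eq_sym.
(* [C w] is only known to be below [+oo]: the norm in [c] covers negative values, and [-oo]
   contradicts the Hölder bound. *)
apply: (@le_trans _ _ (c * x)).
  rewrite /c; case: (C w) Cw h => [r _| |]//.
    rewrite -EFinM lee_fin => /le_trans; apply; rewrite ler_wpM2r ?(ltW x0)//.
    exact: ler_norm.
  by rewrite gt0_mulNye ?lte_fin// leeNy_eq.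
rewrite ler_wpM2l// powR2N_expr.
apply: ge0_ler_powR; rewrite ?nnegrE ?invr_ge0 ?exprn_ge0 ?(ltW a2)//.
exact: dyadic_point_dist.
Qed.

Lemma ler_sum_nat_term (F : nat -> R) (N i : nat) :
  (forall j, 0 <= F j) -> (i < N)%N -> F i <= \sum_(0 <= j < N) F j.
Proof.
move=> F0 iN; rewrite (bigD1_seq i) ?mem_index_iota ?iota_uniq//= lerDl.
by apply: sumr_ge0 => j _.
Qed.

(** The larger of [y] and [z] is at least [x / 2]. A sum of exponentials, unlike a product, can be
    integrated term by term. *)
Lemma expR_powR_le_sum (b k x y z : R) : 0 <= b -> 0 <= k -> 0 <= x ->
  0 <= y -> 0 <= z -> x <= y + z ->
  expR (b * x `^ k) <= expR (b * (2 * y) `^ k) + expR (b * (2 * z) `^ k).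
Proof.
move=> b0 k0 x0 y0 z0 xyz.
have mono u : 0 <= u -> x <= 2 * u -> expR (b * x `^ k) <= expR (b * (2 * u) `^ k).
  move=> u0 xu; rewrite ler_expR ler_wpM2l// ge0_ler_powR ?nnegrE ?mulr_ge0//.
have [yz|zy] := leP y z.
  by apply: ler_wpDl; [exact: expR_ge0|apply: mono => //; lra].
by apply: ler_wpDr; [exact: expR_ge0|apply: mono => //; lra].
Qed.

Lemma integral_expR_powR_lty (Z : T -> R) (A B iota beta p0 : R) :
  0 < iota -> 0 < A -> 0 < beta <= (2 * (A `^ iota^-1 * iota^-1 * expR 1))^-1 ->
  measurable_fun setT Z -> (forall w, 0 <= Z w) ->
  0 <= B -> 0 <= p0 ->
  (forall p, p0 <= p ->
    (\int[P]_w (Z w `^ p)%:E <= (B * (A * p `^ iota) `^ p)%:E)%E) ->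
  (\int[P]_w (expR (beta * Z w `^ iota^-1))%:E < +oo)%E.
Proof.
move=> i0 A0 /andP[b0 bA] mZ Z0 B0 p00 hZ.
apply: (exponential_moment_fin mZ Z0 i0 (ltW A0) B0 (ltW b0) p00 hZ).
have c0 : 0 < A `^ iota^-1 * iota^-1 * expR 1.
  by rewrite !mulr_gt0 ?powR_gt0 ?invr_gt0 ?expR_gt0.
by rewrite -ler_pdivlMr// (le_trans bA)// invfM.
Qed.

(** In [A] the factor 2 comes from splitting a quotient into grid part and error,
    [2 ^ |alpha - eps|] from moving the points to the grid, and [C0 sqrt K] from the moments of grid
    quotients. *)
Lemma holder_const_exponential (C0 iota alpha eps K : R) (Y : R -> {RV P >-> R}) :
  0 < C0 -> 0 < iota -> 0 < alpha -> 0 < eps -> 0 < K ->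
  moments_growth C0 iota Y ->
  (forall eta : R, 0 < eta -> exists L : R,
     0 < L /\ second_moment_le L (2 * alpha - eta) Y) ->
  second_moment_le K (2 * alpha - eps) Y -> holder_paths alpha Y ->
  let A := 2 * 2 `^ `|alpha - eps| * (C0 * Num.sqrt K) in
  exists C : {RV P >-> R},
    {ae P, forall w, (C w)%:E = holder_const (alpha - eps) Y w} /\
    forall beta : R, 0 < beta <= (2 * (A `^ iota^-1 * iota^-1 * expR 1))^-1 ->
      ('E_P[fun w => expR (beta * C w `^ iota^-1)%R] < +oo)%E.
Proof.
move=> C00 i0 a0 e0 K0 mY hL hK hY A.
(* [h] has to be positive for chaining, below [alpha], and above [g] to leave a surplus. *)
pose g := alpha - eps; pose h := Num.max (alpha - eps / 2) (alpha / 2).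
pose theta := Num.min (h - g) h.
have h0 : 0 < h by rewrite lt_max; apply/orP; right; lra.
have ha : h < alpha by rewrite gt_max; apply/andP; split; lra.
have gh : g < h by rewrite lt_max; apply/orP; left; rewrite /g; lra.
have th0 : 0 < theta by rewrite lt_min subr_gt0 gh.
have thg : theta <= h - g by rewrite ge_min lexx.
have thh : theta <= h by rewrite ge_min lexx orbT.
have A0 : 0 < A by rewrite !mulr_gt0 ?powR_gt0// sqrtr_gt0.
have [|L [L0 sL]] := hL (alpha - h); first by rewrite subr_gt0.
have sL' : second_moment_le L (2 * ((alpha + h) / 2)) Y.
  by have -> : 2 * ((alpha + h) / 2) = 2 * alpha - (alpha - h) by field.
have sK' : second_moment_le K (2 * (alpha - eps / 2)) Y.
  by have -> : 2 * (alpha - eps / 2) = 2 * alpha - eps by field.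
have hr : h < (alpha + h) / 2 by lra.
have [M [mM M0 YM [p0 [p01 hM]]]] :=
  dyadic_sup_moments (ltW C00) (ltW L0) mY sL' hr.
have YC := holder_paths_dyadic_cvg a0 hY.
pose c : R := 2 `^ h * (1 + 2 * (1 - 2 `^ (- h))^-1).
have c0 : 0 < c.
  rewrite mulr_gt0 ?powR_gt0// addr_gt0// mulr_gt0// invr_gt0 subr_gt0.
  exact: powR2N_lt1.
have m0 w : 0 <= c * M w by rewrite mulr_ge0// ltW.
have hol : {ae P, forall w, forall s t : R, s \in `[0, 1] -> t \in `[0, 1] ->
    `|Y t w - Y s w| <= c * M w * `|t - s| `^ h}.
  apply: filterS2 YM YC => w YMw YCw.
  exact: (dyadic_increments_holder (M0 w) h0 YMw YCw).
clearbody c.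
have mS := measurable_dyadic_holder_const Y g.
have mC : measurable_fun setT (fun w => fine (dyadic_holder_const Y g w)).
  exact: (measurableT_comp (fine_measurable measurableT) mS).
(* Almost every path is [h]-Hölder with [g < h], so its constant is finite and [fine] loses
   nothing. *)
have CE : {ae P, forall w, (fine (dyadic_holder_const Y g w))%:E = holder_const g Y w}.
  apply: filterS2 hol YC => w hw cw.
  rewrite (holder_const_dyadicE _ cw) fineK// -(holder_const_dyadicE _ cw).
  rewrite ge0_fin_numE ?holder_const_ge0//.
  rewrite (@le_lt_trans _ _ (c * M w)%:E) ?ltry//.
  apply: holder_const_le => s t s01 t01 st.
  have d0 : 0 < `|t - s| by rewrite normr_gt0 subr_eq0 eq_sym.
  rewrite /holder_quotient ler_pdivrMr ?powR_gt0//.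
  rewrite (le_trans (hw s t s01 t01))// ler_wpM2l//.
  by apply: ger_powR; rewrite ?d0 ?dist01_le1// ltW.
exists (RV_of P mC); split => // beta hb.
have b0 : 0 < beta by case/andP: hb.
have k0 : 0 < iota^-1 by rewrite invr_gt0.
pose D := 2 * (2 `^ (1 + theta) * c).
have D0 : 0 < D by rewrite mulr_gt0// mulr_gt0// powR_gt0.
(* The mesh depends on [L], but the exponential moments of the finitely many
   grid quotients only depend on [A]. *)
have [n hn] : exists n, D * (2 `^ (- theta)) ^+ n * (C0 * Num.sqrt L) <= A.
  have : geometric (D * (C0 * Num.sqrt L)) (2 `^ (- theta)) @ \oo --> 0.
    by apply: cvg_geometric; rewrite ger0_norm ?powR_ge0// powR2N_lt1.
  move=> /cvgr0Pnorm_le /(_ _ A0)[n _ /(_ n (leqnn n))] /= hn.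
  by exists n; rewrite mulrAC (le_trans (ler_norm _)).
pose N := (2 ^ n).+1.
(* [q] and [z] are twice the two terms of the rounding bound, as the splitting of the exponential
   demands. *)
pose q i j w := 2 * (2 `^ `|g| *
  holder_quotient g (Y^~ w) (i%:R / 2 ^+ n) (j%:R / 2 ^+ n)).
pose z w := 2 * (2 `^ (1 + theta) * (c * M w) * (2 `^ (- theta)) ^+ n).
have q0 i j w : 0 <= q i j w.
  by rewrite !mulr_ge0 ?powR_ge0// holder_quotient_ge0.
have z0 w : 0 <= z w by rewrite !mulr_ge0 ?powR_ge0 ?exprn_ge0 ?powR_ge0// ltW.
have mq i j : measurable_fun setT (q i j).
  do 2 apply: measurable_funM => //; exact: measurable_holder_quotient.
have mz : measurable_fun setT z.
  do 2 (apply: measurable_funM => //); apply: measurable_funM => //.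
  exact: measurable_funM.
have mexp (f : T -> R) : measurable_fun setT f ->
    measurable_fun setT (fun w => (expR (beta * f w `^ iota^-1))%:E).
  move=> mf; apply/measurable_EFinP; apply: measurableT_comp => //.
  apply: measurable_funM => //.
  exact: (measurableT_comp (measurable_powR iota^-1) mf).
have iq i j : (i < N)%N -> (j < N)%N ->
    (\int[P]_w (expR (beta * q i j w `^ iota^-1))%:E < +oo)%E.
  move=> iN jN; apply: (integral_expR_powR_lty i0 A0 hb (mq i j) (q0 i j) ler01 ler01).
  move=> p p1; rewrite mul1r.
  under eq_integral do rewrite /q mulrA.
  apply: (holder_quotient_moment_le (r := alpha - eps / 2)) => //.
  - exact: ltW.
  - exact: ltW.
  - by rewrite /g; lra.
  - by apply: dyadic_itv; rewrite -ltnS.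
  - by apply: dyadic_itv; rewrite -ltnS.
(* These moments involve [sqrt L], but the choice of [n] brings the constant below [A], so the same
   [beta] works. *)
have iz : (\int[P]_w (expR (beta * z w `^ iota^-1))%:E < +oo)%E.
  have p00 : 0 <= p0 by rewrite (le_trans _ p01).
  apply: (integral_expR_powR_lty i0 A0 hb mz z0 (ler0n R 2) p00).
  move=> p pp; pose e := D * (2 `^ (- theta)) ^+ n.
  have e0' : 0 <= e by rewrite mulr_ge0 ?exprn_ge0 ?powR_ge0// ltW.
  have zE w : z w = e * M w by rewrite /z /e /D; ring.
  have he : e * (C0 * Num.sqrt L) <= A by exact: hn.
  clearbody e.
  under eq_integral do rewrite zE powRM// EFinM.
  rewrite ge0_integralZl//; last 3 first.
  - apply/measurable_EFinP; exact: (measurableT_comp (measurable_powR p) mM).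
  - by move=> w _; rewrite lee_fin powR_ge0.
  - by rewrite lee_fin powR_ge0.
  apply: (le_trans (lee_wpmul2l _ (hM p pp))); first by rewrite lee_fin powR_ge0.
  have cl : 0 <= C0 * Num.sqrt L by rewrite mulr_ge0 ?sqrtr_ge0// ltW.
  rewrite -EFinM lee_fin mulrCA ler_wpM2l// -powRM//; last first.
    by rewrite mulr_ge0 ?powR_ge0.
  rewrite ge0_ler_powR ?nnegrE ?(le_trans p00 pp)//.
  + by rewrite mulr_ge0// mulr_ge0 ?powR_ge0.
  + by rewrite mulr_ge0 ?powR_ge0// ltW.
  by rewrite mulrA ler_wpM2r ?powR_ge0.
(* Summing over all grid pairs makes the majorant independent of where [s] and [t] round to. *)
pose G w := (\sum_(0 <= i < N) \sum_(0 <= j < N) expR (beta * q i j w `^ iota^-1))%R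
  + expR (beta * z w `^ iota^-1).
rewrite unlock.
have GE w : (G w)%:E = (\sum_(0 <= i < N) \sum_(0 <= j < N)
    (expR (beta * q i j w `^ iota^-1))%:E + (expR (beta * z w `^ iota^-1))%:E)%E.
  rewrite /G EFinD -sumEFin; congr (_ + _)%E.
  by apply: eq_bigr => i _; rewrite sumEFin.
have mG1 i : measurable_fun setT
    (fun w => \sum_(0 <= j < N) (expR (beta * q i j w `^ iota^-1))%:E)%E.
  by apply: emeasurable_sum => j; exact: mexp.
apply: (@le_lt_trans _ _ (\int[P]_w (G w)%:E)%E); last first.
  under eq_integral do rewrite GE.
  rewrite ge0_integralD//; last 3 first.
  - by move=> w _; do 2 (apply: sume_ge0 => ? _); rewrite lee_fin expR_ge0.
  - by apply: emeasurable_sum.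
  - exact: mexp.
  rewrite lte_add_pinfty// ge0_integral_sum//; last first.
    by move=> i w _; apply: sume_ge0 => ? _; rewrite lee_fin expR_ge0.
  rewrite big_nat; apply: lte_sum_pinfty => i /andP[_ iN].
  rewrite ge0_integral_sum//; last first.
    by move=> j; exact: mexp.
  rewrite big_nat; apply: lte_sum_pinfty => j /andP[_ jN].
  exact: iq.
apply: ae_ge0_le_integral => //.
- exact: mexp.
- move=> w _; rewrite lee_fin addr_ge0 ?expR_ge0//.
  by do 2 (apply: sumr_ge0 => ? _); exact: expR_ge0.
- by rewrite (funext GE); apply: emeasurable_funD; [exact: emeasurable_sum|exact: mexp].
apply: filterS2 hol CE => w hw Cw _; rewrite lee_fin /=.
apply: (expR_holder_const_le b0 k0 Cw) => s t s01 t01 st.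
have := holder_quotient_le n (m0 w) th0 thg thh hw s01 t01 st.
set Q := holder_quotient g _ (dyadic_point n s) _ => hq.
have Q0 : 0 <= Q by exact: holder_quotient_ge0.
have := expR_powR_le_sum (ltW b0) (ltW k0) (holder_quotient_ge0 g (Y^~ w) s t) _ _ hq.
rewrite !mulr_ge0 ?powR_ge0 ?exprn_ge0 ?powR_ge0 ?(ltW c0)// => /(_ isT isT) /le_trans.
apply; rewrite /G lerD2r.
move: (s01) (t01); rewrite !in_itv /= => /andP[_ s1] /andP[_ t1].
set i := Num.truncn (2 ^+ n * s); set j := Num.truncn (2 ^+ n * t).
have iN : (i < N)%N by rewrite ltnS truncn_dyadic_le.
have jN : (j < N)%N by rewrite ltnS truncn_dyadic_le.
apply: (@le_trans _ _ (\sum_(0 <= l < N) expR (beta * q i l w `^ iota^-1))).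
  by apply: ler_sum_nat_term => // l; exact: expR_ge0.
apply: (ler_sum_nat_term (F := fun l => \sum_(0 <= l' < N) _)) => // l.
by apply: sumr_ge0 => ? _; exact: expR_ge0.
Qed.

End exponential_integrability.

(** [beta0] is chosen before the probability space and the process, which expresses that it depends
    only on [C0], [iota], [alpha], [eps] and the second moment constant [K] at [eps]. *)
Theorem theorem2p14 (R : realType) (C0 iota alpha : R)
    (C0_gt0 : 0 < C0) (iota_ge0 : 0 <= iota) (alpha_gt0 : 0 < alpha) :
  (forall (d : measure_display) (T : measurableType d) (P : probability T R)
      (X : R -> {RV P >-> R}),
    increments_L2 X -> moments_growth C0 iota X ->
    ((exists Y : R -> {RV P >-> R}, modification X Y /\ holder_paths alpha Y)
     <->
     (forall eps : R, 0 < eps -> exists K : R,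
        0 < K /\ second_moment_le K (2 * alpha - eps) X)))
  /\
  (0 < iota -> forall eps K : R, 0 < eps -> 0 < K ->
    exists beta0 : R, 0 < beta0 /\
    forall (d : measure_display) (T : measurableType d) (P : probability T R)
      (X : R -> {RV P >-> R}),
    increments_L2 X -> moments_growth C0 iota X ->
    (forall eta : R, 0 < eta -> exists L : R,
       0 < L /\ second_moment_le L (2 * alpha - eta) X) ->
    second_moment_le K (2 * alpha - eps) X ->
    forall Y : R -> {RV P >-> R}, modification X Y -> holder_paths alpha Y ->
    exists C : {RV P >-> R},
      {ae P, forall w, (C w)%:E = holder_const (alpha - eps) Y w} /\
      forall beta : R, 0 < beta <= beta0 ->
        ('E_P[fun w => expR (beta * C w `^ iota^-1)%R] < +oo)%E).
Proof.
split.
  move=> d T P X L2X mX; split; last exact: (holder_modification C0_gt0 alpha_gt0 mX).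
  move=> [Y [XY hY]] eps eps0.
  have [K [K0 hK]] := holder_second_moment C0_gt0
    (modification_increments_L2 XY L2X) (modification_moments_growth XY mX)
    hY eps0.
  by exists K; split => //; exact: modification_second_moment_le (modification_sym XY) hK.
move=> iota0 eps K eps0 K0.
pose A := 2 * 2 `^ `|alpha - eps| * (C0 * Num.sqrt K).
have A0 : 0 < A by rewrite !mulr_gt0 ?powR_gt0 ?sqrtr_gt0.
exists (2 * (A `^ iota^-1 * iota^-1 * expR 1))^-1; split.
  by rewrite invr_gt0 mulr_gt0// !mulr_gt0 ?powR_gt0 ?invr_gt0 ?expR_gt0.
move=> d T P X _ mX hX hK Y XY hY.
apply: (holder_const_exponential C0_gt0 iota0 alpha_gt0 eps0 K0) hY.
- exact: modification_moments_growth XY mX.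
- move=> eta /hX[L [L0 hL]]; exists L; split => //.
  exact: modification_second_moment_le XY hL.
- exact: modification_second_moment_le XY hK.
Qed.
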